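(* Let $K \subset \mathbb{R}$ be a real number field of degree $d = [K:\mathbb{Q}]$. Then for any real $T \geq 1$, the number of similarity classes $\langle L \rangle$ of well-rounded lattices $L \subset \mathbb{R}^2$ of rank $2$ that are defined over $K$ and satisfy $H(\langle L \rangle) \leq T$ is at most $$\frac{\pi}{2\sqrt{12}} \left( 1 + 4^{2(d+1)} \left( 2 + \sqrt{3} \right)^d T^{2d} \right).$$
   Context: Let $\|\cdot\|$ be the Euclidean norm on $\mathbb{R}^2$. A lattice $L \subset \mathbb{R}^2$ of rank $2$ is well-rounded if its nonzero vectors of minimal Euclidean norm span $\mathbb{R}^2$ over $\mathbb{R}$. Two lattices $L_1, L_2 \subset \mathbb{R}^2$ are similar if $L_2 = \alpha U L_1$ for some real $\alpha > 0$ and some real orthogonal $2\times 2$ matrix $U$; $\langle L \rangle$ denotes the similarity class of $L$. A lattice $L \subset \mathbb{R}^2$ is defined over $K$ if $L \subset K^2$, and a similarity class is defined over $K$ if it contains a lattice defined over $K$. Every well-rounded lattice $L \subset \mathbb{R}^2$ is similar to $M(x_L) = \begin{pmatrix} 1 & x_L \\ x_L & 1\end{pmatrix}\mathbb{Z}^2$ for a unique real number $x_L \in [0, 2-\sqrt{3}]$, and $x_L \in K$ whenever $\langle L \rangle$ is defined over $K$. For a well-rounded similarity class $\langle L\rangle$ defined over $K$, the height is $H(\langle L \rangle) := h(x_L)$, where $h$ is the absolute (multiplicative) Weil height $$h(x) = \prod_{v \in M(K)} \max\{1, |x|_v\}^{d_v/d}, \quad x \in K.$$ Here $M(K)$ is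 the set of places of $K$, $d_v = [K_v : \mathbb{Q}_v]$ is the local degree, archimedean absolute values are $|x|_v = |\sigma(x)|$ for an embedding $\sigma : K \to \mathbb{C}$ corresponding to $v$ (complex conjugate embeddings give the same place), and non-archimedean absolute values extend the usual $p$-adic ones on $\mathbb{Q}$, so that $\prod_{v} |x|_v^{d_v} = 1$ for nonzero $x \in K$. *)

(* Defs.v *)
From HB Require Import structures.
From mathcomp Require Import all_boot all_order all_algebra all_field.
From mathcomp Require Import finmap.
From mathcomp Require Import complex.
From mathcomp Require Import all_classical all_reals all_analysis.

Set Implicit Arguments.
Unset Strict Implicit.
Unset Printing Implicit Defensive.

Import Order.TTheory GRing.Theory Num.Theory.

Local Open Scope classical_set_scope.
Local Open Scope ring_scope.

Section Lattices.
Variable R : realType.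
Implicit Types (L : set 'cV[R]_2) (C : set (set 'cV[R]_2)).

Definition euclidean_norm (u : 'cV[R]_2) : R :=
  Num.sqrt (\sum_(i < 2) u i 0 ^+ 2).

Definition lattice_of (B : 'M[R]_2) : set 'cV[R]_2 :=
  range (fun z : 'cV[int]_2 => B *m map_mx intr z).

Definition full_rank_lattice L : Prop :=
  exists2 B : 'M[R]_2, B \in unitmx & L = lattice_of B.

Definition minimal_vectors L : set 'cV[R]_2 :=
  [set u | [/\ L u, u != 0 &
    forall w, L w -> w != 0 -> euclidean_norm u <= euclidean_norm w]].

Definition spans_plane (A : set 'cV[R]_2) : Prop :=
  forall w : 'cV[R]_2, exists2 s : seq 'cV[R]_2,
    (forall u, u \in s -> A u) & w \in span s.

Definition well_rounded L : Prop :=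
  full_rank_lattice L /\ spans_plane (minimal_vectors L).

Definition similar (L1 L2 : set 'cV[R]_2) : Prop :=
  exists (a : R) (U : 'M[R]_2),
    [/\ 0 < a, U^T *m U = 1%:M & L2 = (fun u => a *: (U *m u)) @` L1].

Definition similarity_class L : set (set 'cV[R]_2) := [set L' | similar L L'].

Definition mx_of_param (x : R) : 'M[R]_2 :=
  \matrix_(i < 2, j < 2) (if i == j then 1 else x).

(* The parameter x_L of a class. It is the only x satisfying the condition
   when C is the class of a well-rounded lattice; the default 0 is not used
   then. *)
Definition class_param C : R :=
  xget 0 [set x | 0 <= x <= 2 - Num.sqrt 3 /\ C (lattice_of (mx_of_param x))].

End Lattices.

Section Places.
Variables (R : realType) (K : fieldExtType rat).
Implicit Types v : K -> R.

Definition absolute_value v : Prop :=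
  [/\ forall x, 0 <= v x, forall x, (v x == 0) = (x == 0),
      forall x y, v (x * y) = v x * v y
    & forall x y, v (x + y) <= v x + v y].

Definition padic_abs (p : nat) (q : rat) : R :=
  if q == 0 then 0
  else p%:R ^ ((logn p `|denq q|)%:Z - (logn p `|numq q|)%:Z).

(* A place is represented by its normalised absolute value, so conjugate
   complex embeddings give one and the same place. *)
Definition archimedean_place v : Prop :=
  exists s : {rmorphism K -> R[i]}, v = (fun x => Normc.normc (s x)).

Definition nonarchimedean_place v : Prop :=
  [/\ absolute_value v, forall x y, v (x + y) <= Num.max (v x) (v y)
    & exists2 p : nat, prime p & forall q : rat, v q%:A = padic_abs p q].

Definition places : set (K -> R) :=
  [set v | archimedean_place v \/ nonarchimedean_place v].

End Places.

Section LocalDegree.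
Variables (R : realType) (K : fieldExtType rat).

Definition cauchy_for (V : zmodType) (w : V -> R) (u : nat -> V) : Prop :=
  forall e : R, 0 < e -> exists N : nat,
    forall m n : nat, (N <= m)%N -> (N <= n)%N -> w (u m - u n) < e.

Definition null_for (V : zmodType) (w : V -> R) (u : nat -> V) : Prop :=
  forall e : R, 0 < e -> exists N : nat,
    forall n : nat, (N <= n)%N -> w (u n) < e.

Definition rat_restriction (v : K -> R) : rat -> R := fun q => v q%:A.

(* Elements of the completion K_v (resp. Q_v) are represented by v-Cauchy
   sequences in K (resp. rat), two sequences representing the same element when
   their difference is v-null. With this convention, the conditions say that
   the classes of b 0, ..., b (n - 1) form a basis of K_v over Q_v. *)
Definition completion_basis (v : K -> R) (n : nat) (b : 'I_n -> nat -> K) :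
    Prop :=
  [/\ forall i, cauchy_for v (b i),
      forall a : 'I_n -> nat -> rat,
        (forall i, cauchy_for (rat_restriction v) (a i)) ->
        null_for v (fun k => \sum_(i < n) a i k *: b i k) ->
        forall i, null_for (rat_restriction v) (a i)
    & forall u : nat -> K, cauchy_for v u ->
        exists2 a : 'I_n -> nat -> rat,
          forall i, cauchy_for (rat_restriction v) (a i)
          & null_for v (fun k => u k - \sum_(i < n) a i k *: b i k)].

(* [K_v : Q_v], which is finite and positive for every place v. *)
Definition local_degree (v : K -> R) : nat :=
  xget 0%N [set n | exists b : 'I_n -> nat -> K, completion_basis v b].

(* For each x, all but finitely many factors are equal to 1. *)
Definition weil_height (x : K) : R :=
  \big[*%R/1]_(v \in @places R K)
    (Num.max 1 (v x) `^ ((local_degree v)%:R / (\dim {:K})%:R)).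

End LocalDegree.

Section Classes.
(* The subfield of R under consideration is the image of iota. *)
Variables (R : realType) (K : fieldExtType rat) (iota : {rmorphism K -> R}).
Implicit Type C : set (set 'cV[R]_2).

Definition lattice_defined_over (L : set 'cV[R]_2) : Prop :=
  forall u, L u -> forall i, exists k : K, u i 0 = iota k.

Definition class_defined_over C : Prop :=
  exists2 L, C L & lattice_defined_over L.

(* The parameter of a well-rounded class defined over K lies in the image of
   iota, so the default 0 is not used for such a class. *)
Definition class_height C : R :=
  weil_height R (xget 0 [set k : K | iota k = class_param C]).

Definition wr_classes_of_bounded_height (T : R) : set (set (set 'cV[R]_2)) :=
  [set C | [/\ exists2 L, well_rounded L & C = similarity_class L,
               class_defined_over C & class_height C <= T]].

End Classes.

(* Main.v *)
Require Import Defs.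
From HB Require Import structures.
From mathcomp Require Import all_boot all_order all_fingroup all_algebra all_field.
From mathcomp Require Import finmap.
From mathcomp Require Import complex.
From mathcomp Require Import all_classical all_reals all_analysis.
From mathcomp Require Import lra ring.

(** Counting classes reduces to counting numbers: the class of a well-rounded
    lattice is determined by its parameter [x], which lies in the image of [K]
    and in the interval from [0] to [2 - sqrt 3].  So it is enough to see that
    the elements [x] of [K] of height at most [T] have well separated images
    under [iota].  This is Liouville's inequality ([liouville]): for [x <> y],
    [1 <= |iota (x - y)| * 2 ^ d * (h x * h y) ^ d], so that two such images are
    at distance at least [1 / (2 ^ d * T ^ (2 d))], and the interval contains at
    most [1 + (2 - sqrt 3) * 2 ^ d * T ^ (2 d)] of them, which is below the
    stated bound by a large margin.

    Liouville's inequality follows from the product formula over the rationals,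
    applied to the norm [N] of [z = x - y], once one knows that, for the usual
    absolute value and for every p-adic one, [|N| <= \prod_v v z ^ n_v], with
    distinct places [v] of [K] and with exponents [n_v] bounded by the local
    degrees ([places_above]).  Write [K] as [Q[X] / P]; the norm is then the
    determinant of the multiplication by a polynomial modulo [P].  Over the
    real numbers or over the p-adic numbers, [P] is a product of distinct
    irreducible factors [f], and the norm is the product of the norms modulo
    the factors ([normmod_prod]).  An absolute value [nu] on [F[X] / f]
    restricts to a place of [K].  By compactness the coordinates modulo [f] are
    [O(nu)] ([sumnorm_le_ra]), and two facts follow: the norm is at most
    [nu ^ deg f] ([normmod_le_ra]), and the local degree of the place is at
    least [deg f] ([local_degree_ge]).  Different factors give different places,
    because a factor is a limit of rational polynomials ([residue_abs_eq]).

    Over the real numbers [nu] is the modulus of the value at a complex root of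
    [f].  Over the p-adic numbers [nu] is the root of order [deg f] of the norm,
    and the ultrametric inequality comes again from compactness
    ([norm1D_le1]).

    Finally the height is a product over the places where its factor is not
    [1], so it bounds partial products only after these places are known to be
    finitely many ([finite_height_support]): if [v x > 1] with [v] above [p],
    then [p] divides a denominator of the minimal polynomial of [x], and weak
    approximation shows that at most [d] places lie above [p]. *)

Set Implicit Arguments.
Unset Strict Implicit.
Unset Printing Implicit Defensive.

Import Order.TTheory GRing.Theory Num.Theory.
Import numFieldNormedType.Exports.

Local Open Scope classical_set_scope.
Local Open Scope ring_scope.

(** * Norms of polynomials modulo a polynomial *)

Section NormMod.
Variable F : fieldType.
Implicit Types f g h : {poly F}.

(** The size [n] is a parameter, meant to be the degree of [f], so that sums
    of degrees give no casts. *)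
Definition mulmod_mx n f g : 'M[F]_n :=
  \matrix_(i < n) poly_rV ((g * 'X^i) %% f).

Definition normmod n f g : F := \det (mulmod_mx n f g).

Lemma mulmod_mxE n f g (u : 'rV[F]_n) :
  u *m mulmod_mx n f g = poly_rV ((g * rVpoly u) %% f).
Proof.
rewrite mulmx_sum_row /rVpoly poly_def mulr_sumr.
rewrite (big_morph (fun p => p %% f) (modpD f) (mod0p f)) linear_sum /=.
apply: eq_bigr => i _; rewrite rowK valK -scalerAr modpZl linearZ /=.
by [].
Qed.

Section Fixed.
Variables (n : nat) (f : {poly F}).
Hypothesis sf : size f = n.+1.

Lemma size_modp_le g : (size (g %% f)%R <= n)%N.
Proof.
have f0 : f != 0 by rewrite -size_poly_gt0 sf.
by have := ltn_modpN0 g f0; rewrite sf ltnS.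
Qed.

Lemma mulmod_mxM g h :
  mulmod_mx n f (g * h) = mulmod_mx n f g *m mulmod_mx n f h.
Proof.
apply/row_matrixP => i; rewrite row_mul !rowK mulmod_mxE poly_rV_K ?size_modp_le //.
by rewrite modp_mul mulrCA mulrA.
Qed.

Lemma mulmod_mx_modp g : mulmod_mx n f (g %% f) = mulmod_mx n f g.
Proof.
by apply/row_matrixP => i; rewrite !rowK mulrC modp_mul mulrC.
Qed.

Lemma mulmod_mxC (c : F) : mulmod_mx n f c%:P = c%:M.
Proof.
apply/row_matrixP => i; rewrite !rowK mul_polyC modp_small; last first.
  by rewrite sf (leq_ltn_trans (size_scale_leq _ _))// size_polyXn ltnS.
apply/rowP => j; rewrite !mxE coefZ coefXn -val_eqE /= eq_sym.
by case: eqP; rewrite ?mulr1 ?mulr0.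
Qed.

Lemma normmodM g h : normmod n f (g * h) = normmod n f g * normmod n f h.
Proof. by rewrite /normmod mulmod_mxM det_mulmx. Qed.

Lemma normmod_modp g : normmod n f (g %% f) = normmod n f g.
Proof. by rewrite /normmod mulmod_mx_modp. Qed.

Lemma normmodC (c : F) : normmod n f c%:P = c ^+ n.
Proof. by rewrite /normmod mulmod_mxC det_scalar. Qed.

Lemma normmodX g m : normmod n f (g ^+ m) = normmod n f g ^+ m.
Proof.
elim: m => [|m IH]; last by rewrite !exprS normmodM IH.
by rewrite !expr0 normmodC expr1n.
Qed.

Lemma normmod_neq0 g : coprimep f g -> normmod n f g != 0.
Proof.
case/Bezout_eq1_coprimepP => -[u v] /= uv.
apply/eqP => g0; suff: normmod n f 1 = 0.
  by rewrite normmodC expr1n => /eqP; rewrite oner_eq0.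
rewrite -uv addrC -normmod_modp modpD modp_mull addr0 normmod_modp.
by rewrite normmodM g0 mulr0.
Qed.

End Fixed.

(** In the basis [X ^ i] for [i < n1], followed by [f1 X ^ i] for [i < n2], the
    multiplication by [g] modulo [f1 f2] is block triangular. *)
Lemma normmodMl n1 n2 f1 f2 g : size f1 = n1.+1 -> size f2 = n2.+1 ->
  normmod (n1 + n2) (f1 * f2) g = normmod n1 f1 g * normmod n2 f2 g.
Proof.
move=> s1 s2.
have f10 : f1 != 0 by rewrite -size_poly_gt0 s1.
have f20 : f2 != 0 by rewrite -size_poly_gt0 s2.
have s12 : size (f1 * f2) = (n1 + n2).+1.
  by rewrite size_mul // s1 s2 addSn addnS.
pose Tu : 'M[F]_(n1, n1 + n2) := \matrix_(i < n1) poly_rV 'X^i.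
pose Td : 'M[F]_(n2, n1 + n2) := \matrix_(j < n2) poly_rV (f1 * 'X^j).
pose E : 'M[F]_(n1, n2) :=
  \matrix_(i < n1) poly_rV (((g * 'X^i) %% (f1 * f2)) %/ f1).
have mulTu m (u : 'M[F]_(m, n1)) i :
    row i (u *m Tu) = poly_rV (rVpoly (row i u)).
  rewrite row_mul mulmx_sum_row [rVpoly _ in RHS]poly_def linear_sum /=.
  by apply: eq_bigr => k _; rewrite rowK valK linearZ.
have mulTd m (u : 'M[F]_(m, n2)) i :
    row i (u *m Td) = poly_rV (f1 * rVpoly (row i u)).
  rewrite row_mul mulmx_sum_row [rVpoly _ in RHS]poly_def mulr_sumr linear_sum /=.
  by apply: eq_bigr => k _; rewrite rowK valK -scalerAr linearZ.
have key : col_mx Tu Td *m mulmod_mx (n1 + n2) (f1 * f2) g =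
    block_mx (mulmod_mx n1 f1 g) E 0 (mulmod_mx n2 f2 g) *m col_mx Tu Td.
  rewrite mul_col_mx mul_block_col mul0mx add0r; congr col_mx.
    apply/row_matrixP => i; rewrite linearD /= mulTu mulTd row_mul rowK.
    rewrite mulmod_mxE poly_rV_K; last first.
      by rewrite size_polyXn (leq_trans (ltn_ord i)) // leq_addr.
    rewrite -linearD /= !rowK !poly_rV_K ?(size_modp_le s1) //; last first.
      rewrite size_divp // s1 leq_subLR /=.
      exact: size_modp_le.
    set q := g * _; congr poly_rV.
    rewrite {1}(divp_eq (q %% (f1 * f2)) f1) addrC [_ * f1]mulrC.
    congr (_ + _).
    by rewrite [in RHS](divp_eq q (f1 * f2)) modpD mulrCA modp_mulr add0r.
  apply/row_matrixP => i; rewrite mulTd row_mul !rowK.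
  rewrite mulmod_mxE !poly_rV_K ?(size_modp_le s2) //; last first.
    rewrite (leq_trans (size_polyMleq _ _)) // s1 addSn /= leq_add2l.
    by rewrite size_polyXn.
  rewrite mulrCA {1}(divp_eq (g * 'X^i) f2) mulrDr mulrCA.
  rewrite modp_addl_mul_small // s12 ltnS (leq_trans (size_polyMleq _ _)) //.
  by rewrite s1 addSn /= leq_add2l size_modp_le.
have T0 : \det (col_mx Tu Td) != 0.
  rewrite -unitfE -unitmxE -row_free_unit -kermx_eq0; apply/eqP/row_matrixP => i.
  set u := row i _; rewrite row0.
  have : u *m col_mx Tu Td = 0 by apply/sub_kermxP; exact: row_sub.
  rewrite -[u]hsubmxK mul_row_col.
  set a := lsubmx u; set b := rsubmx u => /(congr1 (row 0)).
  have r0 m (c : 'rV[F]_m) : row 0 c = c by apply/rowP => k; rewrite mxE.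
  rewrite linearD /= mulTu mulTd !r0 -linearD /= => /(congr1 rVpoly).
  have sa : (size (rVpoly a) < size f1)%N by rewrite s1 ltnS size_poly.
  rewrite linear0 poly_rV_K; last first.
    rewrite (leq_trans (size_polyD _ _)) // geq_max; apply/andP; split.
      by rewrite (leq_trans (size_poly _ _)) // leq_addr.
    rewrite (leq_trans (size_polyMleq _ _)) // s1 addSn /= leq_add2l.
    exact: size_poly.
  rewrite addrC mulrC => ab0.
  have := divp_addl_mul_small (rVpoly b) sa; rewrite ab0 div0p => /esym b0.
  have := modp_addl_mul_small (rVpoly b) sa; rewrite ab0 mod0p => /esym a0.
  by rewrite -(rVpolyK a) -(rVpolyK b) a0 b0 !linear0 row_mx0.
have := congr1 determinant key; rewrite !det_mulmx det_ublock mulrC.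
by move/(mulIf T0).
Qed.

End NormMod.

Lemma map_mulmod_mx (F E : fieldType) (j : {rmorphism F -> E}) n (f g : {poly F}) :
  map_mx j (mulmod_mx n f g) = mulmod_mx n (map_poly j f) (map_poly j g).
Proof.
apply/matrixP => i k; rewrite !mxE -(map_polyXn j) -rmorphM -map_modp.
by rewrite coef_map.
Qed.

Lemma map_normmod (F E : fieldType) (j : {rmorphism F -> E}) n (f g : {poly F}) :
  j (normmod n f g) = normmod n (map_poly j f) (map_poly j g).
Proof. by rewrite /normmod -map_mulmod_mx det_map_mx. Qed.

Lemma mulmod_mx_rVpoly (F : fieldType) n (f : {poly F}) (u : 'rV[F]_n) i l :
  mulmod_mx n f (rVpoly u) i l = \sum_k u 0 k * (('X^k * 'X^i) %% f)`_l.
Proof.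
rewrite !mxE [rVpoly u]poly_def mulr_suml.
rewrite (big_morph (fun p => p %% f) (modpD f) (mod0p f)) coef_sum.
by apply: eq_bigr => k _; rewrite valK -scalerAl modpZl coefZ.
Qed.

(** * Multiplicative seminorms *)

Section MultSeminorm.
Variable R : realType.

Record mult_seminorm (A : nzRingType) (v : A -> R) : Prop := MultSeminorm {
  ms_ge0 : forall x, 0 <= v x;
  ms0 : v 0 = 0;
  ms1 : v 1 = 1;
  msM : forall x y, v (x * y) = v x * v y;
  msD : forall x y, v (x + y) <= v x + v y }.

Section Theory.
Variables (A : nzRingType) (v : A -> R).
Hypothesis hv : mult_seminorm v.

Lemma msX x m : v (x ^+ m) = v x ^+ m.
Proof.
elim: m => [|m IH]; first by rewrite !expr0 ms1.
by rewrite !exprS (msM hv) IH.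
Qed.

Lemma msN x : v (- x) = v x.
Proof.
rewrite -mulN1r (msM hv); suff -> : v (-1) = 1 by rewrite mul1r.
have /eqP : v (-1) ^+ 2 = 1 by rewrite -msX sqrrN expr1n (ms1 hv).
rewrite sqrf_eq1 => /orP[/eqP //|/eqP h].
by have := ms_ge0 hv (-1); rewrite h oppr_ge0 ler10.
Qed.

Lemma msB x y : v (x - y) <= v x + v y.
Proof. by rewrite -(msN y) (msD hv). Qed.

Lemma msBC x y : v (x - y) = v (y - x).
Proof. by rewrite -msN opprB. Qed.

Lemma ms_dist x y : `|v x - v y| <= v (x - y).
Proof.
rewrite ler_norml; apply/andP; split.
  rewrite lerNl opprB lerBlDr msBC.
  by apply: le_trans (msD hv _ _); rewrite subrK.
by rewrite lerBlDr; apply: le_trans (msD hv _ _); rewrite subrK.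
Qed.

Lemma ms_sum I (r : seq I) (P : pred I) (a : I -> A) :
  v (\sum_(i <- r | P i) a i) <= \sum_(i <- r | P i) v (a i).
Proof.
elim/big_rec2: _ => [|i y x _ h]; first by rewrite (ms0 hv).
by apply: le_trans (msD hv _ _) _; rewrite lerD2l.
Qed.

Lemma ms_prod I (r : seq I) (P : pred I) (a : I -> A) :
  v (\prod_(i <- r | P i) a i) = \prod_(i <- r | P i) v (a i).
Proof. exact: (big_morph v (msM hv) (ms1 hv)). Qed.

Lemma ultra_sum I (r : seq I) (P : pred I) (a : I -> A) (B : R) :
  (forall x y, v (x + y) <= Num.max (v x) (v y)) -> 0 <= B ->
  (forall i, P i -> v (a i) <= B) -> v (\sum_(i <- r | P i) a i) <= B.
Proof.
move=> ultra B0 h; elim/big_rec: _ => [|i y Pi hy]; first by rewrite (ms0 hv).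
by rewrite (le_trans (ultra _ _)) // ge_max h.
Qed.

End Theory.

Lemma msV (F : fieldType) (v : F -> R) x : mult_seminorm v -> v x^-1 = (v x)^-1.
Proof.
move=> hv; have [->|x0] := eqVneq x 0; first by rewrite invr0 (ms0 hv) invr0.
have h : v x * v x^-1 = 1 by rewrite -(msM hv) divff // (ms1 hv).
have vx0 : v x != 0 by apply: contra_eq_neq h => ->; rewrite mul0r eq_sym oner_neq0.
by apply: (mulfI vx0); rewrite h divff.
Qed.

Lemma ms_eq0 (F : fieldType) (v : F -> R) x : mult_seminorm v -> (v x == 0) = (x == 0).
Proof.
move=> hv; apply/idP/idP => [/eqP vx|/eqP ->]; last by rewrite (ms0 hv).
apply/negPn/negP => x0; have : v (x * x^-1) = 1 by rewrite divff // (ms1 hv).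
by move/eqP; rewrite (msM hv) vx mul0r eq_sym oner_eq0.
Qed.

(** Power boundedness is how every sharp estimate on absolute values is
    obtained from a crude one. *)
Lemma le_of_expr_le (a b C : R) : 0 <= a -> 0 <= b ->
  (forall m, a ^+ m <= C * b ^+ m) -> a <= b.
Proof.
move=> a0 b0 h; rewrite leNgt; apply/negP => ab.
have [b0'|bn0] := eqVneq b 0.
  by have := h 1%N; rewrite b0' !expr1 mulr0 leNgt; rewrite b0' in ab; rewrite ab.
have bp : 0 < b by rewrite lt_def bn0.
pose t := a / b - 1.
have tp : 0 < t by rewrite subr_gt0 ltr_pdivlMr // mul1r.
have bern m : 1 + t *+ m <= (1 + t) ^+ m.
  elim: m => [|m IH]; first by rewrite mulr0n addr0 expr0.
  rewrite exprS; apply: le_trans (ler_wpM2l _ IH); last by lra.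
  rewrite mulrDr mulr1 mulrDl mul1r mulrS.
  have : 0 <= t * (t *+ m) by rewrite mulr_ge0 ?mulrn_wge0 // ltW.
  lra.
have t1 : 1 + t = a / b by rewrite /t; ring.
pose m := Num.truncn (C / t).
have hm : C < t *+ m.+1.
  by have := truncnS_gt (C / t); rewrite -/m ltr_pdivrMr // mulr_natl.
have := bern m.+1; rewrite t1 expr_div_n => h1.
have := h m.+1; rewrite -ler_pdivrMr ?exprn_gt0 // => /(le_trans h1).
by move: (t *+ m.+1) hm => y; lra.
Qed.

End MultSeminorm.

(** * Local fields *)

(** Along a fixed free ultrafilter every bounded real sequence converges, so
    that compactness arguments need no extraction of subsequences. *)
Definition free_ultrafilter (U : set_system nat) : Prop :=
  UltraFilter U /\ \oo `<=` U.

Lemma free_ultrafilter_exists : exists U, free_ultrafilter U.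
Proof.
by have [U [UU sU]] := ultraFilterLemma (F := \oo) _; exists U; split.
Qed.

Section LocalField.
Variable R : realType.
Variable U : set_system nat.
Hypothesis UU : free_ultrafilter U.
Let Upf : ProperFilter U := @ultra_proper _ _ (proj1 UU).
Let Uf : Filter U := @filter_filter _ _ Upf.
#[local] Existing Instance Upf.
#[local] Existing Instance Uf.

Lemma cvg_free (a : nat -> R) (l : R) : a @ \oo --> l -> a @ U --> l.
Proof. by move=> h A /h; exact: (proj2 UU). Qed.

Lemma cvg0_le (a b : nat -> R) : (forall k, 0 <= a k <= b k) ->
  b @ U --> (0 : R) -> a @ U --> (0 : R).
Proof.
move=> ab b0; apply: (@squeeze_cvgr _ _ _ _ (cst 0) b) => //.
- by near=> k; rewrite ab.
- exact: cvg_cst.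
Unshelve. all: by end_near. Qed.

Lemma cvg_bigsum I (r : seq I) (a : I -> nat -> R) (l : I -> R) :
  (forall i, a i @ U --> l i) ->
  (fun k => \sum_(i <- r) a i k) @ U --> \sum_(i <- r) l i.
Proof.
move=> h; elim: r => [|i r IH].
  by under eq_fun do rewrite big_nil; rewrite big_nil; exact: cvg_cst.
by under eq_fun do rewrite big_cons; rewrite big_cons; exact: cvgD.
Qed.

Lemma real_ultralimit (a : nat -> R) (B : R) : (forall k, `|a k| <= B) ->
  exists l : R, a @ U --> l.
Proof.
move=> aB; have := @segment_compact R (- B) B; rewrite compact_ultra.
move=> /(_ (a @ U)) [].
- split; first exact: fmap_proper_filter.
  move=> G GF aUG; apply/seteqP; split => //; last first.
  move=> A GA.
  have [//|] := in_ultra_setVsetC (a @^-1` A) (proj1 UU).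
  move=> nA; have GnA : G (~` A) by apply: aUG; exact: nA.
  by have [x []] := @filter_ex _ G _ _ (@filterI _ G _ _ _ GA GnA).
- apply: (@filterE _ U) => k; have := aB k.
  by rewrite ler_norml /= in_itv.
- by move=> l [_ h]; exists l.
Qed.

(** The last field expresses local compactness: the real numbers and the p-adic
    numbers are treated alike from here on. *)
Record local_field (F : fieldType) (absF : F -> R)
    (j : {rmorphism rat -> F}) : Prop := LocalField {
  lf_abs : mult_seminorm absF;
  lf_dense : forall x (e : R), 0 < e -> exists q, absF (x - j q) < e;
  lf_ultralimit : forall (x : nat -> F) (B : R), (forall k, absF (x k) <= B) ->
    exists l, (fun k => absF (x k - l)) @ U --> (0 : R) }.

Section Field.
Variables (F : fieldType) (absF : F -> R) (j : {rmorphism rat -> F}).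
Hypothesis LF : local_field absF j.
Let hF := lf_abs LF.

Definition tends (x : nat -> F) (l : F) : Prop :=
  (fun k => absF (x k - l)) @ U --> (0 : R).

Lemma tends_cst l : tends (fun=> l) l.
Proof. by rewrite /tends subrr (ms0 hF); exact: cvg_cst. Qed.

Lemma tendsD x y l m : tends x l -> tends y m -> tends (fun k => x k + y k) (l + m).
Proof.
move=> xl ym; apply: (@cvg0_le _ (fun k => absF (x k - l) + absF (y k - m))).
  by move=> k; rewrite (ms_ge0 hF) /= opprD addrACA (msD hF).
by rewrite -[X in _ --> X]addr0; apply: cvgD.
Qed.

Lemma tendsM x y l m : tends x l -> tends y m -> tends (fun k => x k * y k) (l * m).
Proof.
move=> xl ym.
apply: (@cvg0_le _ (fun k => absF (x k - l) * absF (y k - m) +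
   (absF l * absF (y k - m) + absF m * absF (x k - l)))).
  move=> k; rewrite (ms_ge0 hF) /= -!(msM hF).
  have -> : x k * y k - l * m = (x k - l) * (y k - m) +
    (l * (y k - m) + m * (x k - l)) by ring.
  by apply: le_trans (msD hF _ _) _; rewrite lerD2l (msD hF).
have -> : (0 : R) = 0 * 0 + (absF l * 0 + absF m * 0) by rewrite !mulr0 !addr0.
apply: cvgD; first exact: cvgM.
by apply: cvgD; apply: cvgM => //; exact: cvg_cst.
Qed.

Lemma tends_sum I (r : seq I) (x : I -> nat -> F) l :
  (forall i, tends (x i) (l i)) ->
  tends (fun k => \sum_(i <- r) x i k) (\sum_(i <- r) l i).
Proof.
move=> h; elim: r => [|i r IH].
  by under eq_fun do rewrite big_nil; rewrite big_nil; exact: tends_cst.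
by under eq_fun do rewrite big_cons; rewrite big_cons; exact: tendsD.
Qed.

Lemma tends_prod I (r : seq I) (x : I -> nat -> F) l :
  (forall i, tends (x i) (l i)) ->
  tends (fun k => \prod_(i <- r) x i k) (\prod_(i <- r) l i).
Proof.
move=> h; elim: r => [|i r IH].
  by under eq_fun do rewrite big_nil; rewrite big_nil; exact: tends_cst.
by under eq_fun do rewrite big_cons; rewrite big_cons; exact: tendsM.
Qed.

Lemma tends_abs x l : tends x l -> absF \o x @ U --> absF l.
Proof.
move=> xl; apply/subr_cvg0/norm_cvg0P; apply: cvg0_le xl => k /=.
by rewrite normr_ge0 (ms_dist hF).
Qed.

Definition sumnorm n (u : 'rV[F]_n) : R := \sum_i absF (u 0 i).

Lemma sumnorm_ge0 n (u : 'rV[F]_n) : 0 <= sumnorm u.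
Proof. by apply: sumr_ge0 => i _; exact: (ms_ge0 hF). Qed.

Lemma le_sumnorm n (u : 'rV[F]_n) i : absF (u 0 i) <= sumnorm u.
Proof.
rewrite /sumnorm (bigD1 i) //= lerDl.
by apply: sumr_ge0 => k _; exact: (ms_ge0 hF).
Qed.

(** The compactness of the unit sphere of [F^n]: a continuous homogeneous
    function that does not vanish outside the origin dominates the norm. *)
Lemma homogeneous_lower_bound n e (Phi : 'rV[F]_n -> R) :
  (forall c u, Phi (c *: u) = absF c ^+ e.+1 * Phi u) ->
  (forall u, u != 0 -> 0 < Phi u) ->
  (forall (u : nat -> 'rV[F]_n) (l : 'rV[F]_n), (forall i, tends (fun k => u k 0 i) (l 0 i)) ->
     Phi \o u @ U --> Phi l) ->
  exists2 C, 0 < C & forall u, sumnorm u ^+ e.+1 <= C * Phi u.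
Proof.
move=> homPhi posPhi contPhi; apply: contrapT => nC.
have Phi0 : Phi 0 = 0.
  by have := homPhi 0 0; rewrite scale0r (ms0 hF) expr0n mul0r.
have Phi_ge0 u : 0 <= Phi u.
  by have [->|/posPhi/ltW //] := eqVneq u 0; rewrite Phi0.
have bad k : exists u, k.+1%:R * Phi u < sumnorm u ^+ e.+1.
  apply: contrapT => h; apply: nC; exists k.+1%:R; first by rewrite ltr0n.
  by move=> u; rewrite leNgt; apply/negP => hu; apply: h; exists u.
have {}bad k : exists u : 'rV[F]_n,
    [/\ forall i, absF (u 0 i) <= 1, 1 <= sumnorm u &
        Phi u <= n%:R ^+ e.+1 / k.+1%:R].
  have [u hu] := bad k.
  have u0 : u != 0.
    apply: contraTneq hu => ->; rewrite Phi0 mulr0 -leNgt /sumnorm.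
    by rewrite big1 ?expr0n // => i _; rewrite mxE (ms0 hF).
  have [i0 ui0] : exists i0, u 0 i0 != 0.
    by have /rV0Pn[i hi] := u0; exists i.
  pose i1 := [arg max_(i > i0) absF (u 0 i)]%O.
  have maxi i : absF (u 0 i) <= absF (u 0 i1).
    by rewrite /i1; case: arg_maxP => // m _ hm; exact: hm.
  have cp : 0 < absF (u 0 i1).
    by apply: lt_le_trans (maxi i0); rewrite lt_def (ms_ge0 hF) (ms_eq0 _ hF) ui0.
  have c0 : u 0 i1 != 0 by rewrite -(ms_eq0 _ hF) gt_eqF.
  pose c := u 0 i1; pose w := c^-1 *: u.
  have w1 i : absF (w 0 i) <= 1.
    by rewrite mxE (msM hF) (msV _ hF) mulrC ler_pdivrMr // mul1r.
  have sw : sumnorm w <= n%:R.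
    apply: le_trans (ler_sum _ (fun i _ => w1 i)) _.
    by rewrite sumr_const card_ord.
  exists w; split => //.
    apply: le_trans (le_sumnorm w i1).
    by rewrite mxE mulVf // (ms1 hF).
  have suw : sumnorm u = absF c * sumnorm w.
    rewrite /sumnorm mulr_sumr; apply: eq_bigr => i _.
    by rewrite -(msM hF) mxE mulrA divff // mul1r.
  have uw : u = c *: w by rewrite scalerA divff // scale1r.
  move: hu; rewrite {1}uw homPhi suw exprMn mulrCA ltr_pM2l ?exprn_gt0 // => hu.
  rewrite ler_pdivlMr ?ltr0n // mulrC (le_trans (ltW hu)) //.
  by rewrite lerXn2r // ?nnegrE ?sumnorm_ge0.
have {bad}[w hw] := choice bad.
have lim i : exists l, tends (fun k => w k 0 i) l.
  by apply: (lf_ultralimit LF) => k; case: (hw k) => + _ _; apply.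
have {lim}[l hl] := choice lim.
pose L := \row_i l i.
have wL i : tends (fun k => w k 0 i) (L 0 i) by rewrite mxE.
have PhiL0 : Phi L = 0.
  apply: (cvg_unique _ (contPhi w L wL)) => //.
  apply: (@cvg0_le _ (fun k => n%:R ^+ e.+1 / k.+1%:R)) => [k|].
    by rewrite Phi_ge0 /=; case: (hw k).
  apply: cvg_free; rewrite -[X in _ --> X](mulr0 (n%:R ^+ e.+1)).
  by apply: cvgM; [exact: cvg_cst|exact: cvg_harmonic].
have L0 : L = 0.
  by apply/eqP/negPn/negP => /posPhi; rewrite PhiL0 ltxx.
have : (fun k => sumnorm (w k)) @ U --> (0 : R).
  rewrite -[X in _ --> X](_ : \sum_(i < n) 0 = 0); last by rewrite big1.
  apply: cvg_bigsum => i.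
  by have := tends_abs (wL i); rewrite L0 mxE (ms0 hF).
move/cvgr_lt => /(_ 1 ltr01) /filter_ex [k].
by case: (hw k) => _ h _; rewrite /= ltNge h.
Qed.

Lemma poly_approx m (g : {poly F}) (e : R) : 0 < e -> (size g <= m)%N ->
  exists h : {poly rat}, (size h <= m)%N /\
    forall i, absF (g`_i - (map_poly j h)`_i) < e.
Proof.
move=> e0 sg.
have [q hq] := choice (fun i => lf_dense LF g`_i e0).
exists (\poly_(i < m) q i); split; first exact: size_poly.
move=> i; rewrite coef_map coef_poly /=; case: ltnP => [_|mi]; first exact: hq.
by rewrite rmorph0 nth_default ?(leq_trans sg) // subr0 (ms0 hF).
Qed.

(** An absolute value on [F[X] / f] extending that of [F], read on
    polynomials so that no quotient ring has to be formed. *)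
Record residue_abs (f : {poly F}) (nu : {poly F} -> R) : Prop := ResidueAbs {
  ra_ms : mult_seminorm nu;
  ra_cst : forall c, nu c%:P = absF c;
  ra_eq0 : forall g, nu g = 0 <-> f %| g }.

Section NormBound.
Variables (n : nat) (f : {poly F}).
Hypothesis sf : size f = n.+1.

Lemma tends_normmod (u : nat -> 'rV[F]_n) (l : 'rV[F]_n) :
  (forall i, tends (fun k => u k 0 i) (l 0 i)) ->
  tends (fun k => normmod n f (rVpoly (u k))) (normmod n f (rVpoly l)).
Proof.
move=> ul; rewrite /normmod /determinant; apply: tends_sum => s.
apply: tendsM; first exact: tends_cst.
apply: tends_prod => i; rewrite mulmod_mx_rVpoly.
under eq_fun do rewrite mulmod_mx_rVpoly.
by apply: tends_sum => m; apply: tendsM => //; exact: tends_cst.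
Qed.

Lemma normmod_le_sumnorm : exists2 C, 0 <= C &
  forall g, absF (normmod n f g) <= C * sumnorm (poly_rV (g %% f) : 'rV_n) ^+ n.
Proof.
pose E := \sum_(p : 'I_n * ('I_n * 'I_n))
  absF (('X^(p.1) * 'X^(p.2.1)) %% f)`_(p.2.2).
have E0 : 0 <= E by apply: sumr_ge0 => p _; exact: (ms_ge0 hF).
have entry (u : 'rV[F]_n) i l :
    absF (mulmod_mx n f (rVpoly u) i l) <= E * sumnorm u.
  rewrite mulmod_mx_rVpoly (le_trans (ms_sum hF _ _ _)) // mulr_sumr.
  apply: ler_sum => k _; rewrite (msM hF) mulrC ler_wpM2r ?(ms_ge0 hF) //.
  rewrite /E (bigD1 (k, (i, l))) //= lerDl.
  by apply: sumr_ge0 => p _; exact: (ms_ge0 hF).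
exists (\sum_(s : 'S_n) E ^+ n); first by apply: sumr_ge0 => s _; exact: exprn_ge0.
move=> g; rewrite -normmod_modp // /normmod /determinant.
apply: le_trans (ms_sum hF _ _ _) _; rewrite mulr_suml; apply: ler_sum => s _.
rewrite (msM hF) (_ : absF ((-1) ^+ s) = 1) ?mul1r; last first.
  by rewrite (msX hF) (msN hF) (ms1 hF) expr1n.
rewrite (ms_prod hF) -exprMn -[X in _ <= _ ^+ X](card_ord n) -prodr_const.
apply: ler_prod => i _; rewrite (ms_ge0 hF) /=.
by have := entry (poly_rV (g %% f)) i (s i); rewrite poly_rV_K ?(size_modp_le sf).
Qed.

Variable nu : {poly F} -> R.
Hypothesis hnu : residue_abs f nu.
Let hn := ra_ms hnu.

Lemma ra_modp g : nu (g %% f) = nu g.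
Proof.
apply/eqP; rewrite -subr_eq0 -normr_le0; apply: le_trans (ms_dist hn _ _) _.
suff -> : nu (g %% f - g) = 0 by [].
apply/(ra_eq0 hnu); rewrite {2}(divp_eq g f) opprD addrCA subrr addr0.
by rewrite dvdpNr dvdp_mull.
Qed.

Lemma ra_le_coef m : exists2 A, 0 <= A & forall (g : {poly F}) (e : R),
  (size g <= m)%N -> (forall i, absF g`_i <= e) -> nu g <= A * e.
Proof.
exists (\sum_(i < m) nu 'X ^+ i).
  by apply: sumr_ge0 => i _; rewrite exprn_ge0 ?(ms_ge0 hn).
move=> g e sg ge.
have -> : g = \sum_(i < m) (g`_i)%:P * 'X^i.
  rewrite -{1}(coefK g) (poly_def _ _); under eq_bigr do rewrite -mul_polyC.
  rewrite (big_ord_widen _ (fun i => (g`_i)%:P * 'X^i) sg) big_mkcond /=.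
  apply: eq_bigr => i _; case: ltnP => // si.
  by rewrite nth_default // mul0r.
rewrite (le_trans (ms_sum hn _ _ _)) // mulr_suml ler_sum // => i _.
rewrite (msM hn) (ra_cst hnu) (msX hn) mulrC ler_wpM2l ?exprn_ge0 ?(ms_ge0 hn) //.
Qed.

(** Coordinates are controlled by any absolute value, as an absolute value is a
    continuous function that vanishes only on the multiples of [f]. *)
Lemma sumnorm_le_ra : exists2 C, 0 < C &
  forall g, sumnorm (poly_rV (g %% f) : 'rV_n) <= C * nu g.
Proof.
have [||//|C C0 hC] := @homogeneous_lower_bound n 0 (fun u => nu (rVpoly u)).
- by move=> c u; rewrite linearZ /= -mul_polyC (msM hn) (ra_cst hnu) expr1.
- move=> u u0; rewrite lt_def (ms_ge0 hn) andbT; apply: contra u0 => /eqP.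
  move/(ra_eq0 hnu)/modp_eq0P; rewrite modp_small ?sf ?ltnS ?size_poly //.
  by move=> h; rewrite -(rVpolyK u) h linear0.
- move=> u l ul.
  apply/subr_cvg0/norm_cvg0P.
  have [A A0 hA] := ra_le_coef n.
  apply: (@cvg0_le _ (fun k => A * sumnorm (u k - l))) => [k|].
    rewrite normr_ge0 /=; apply: le_trans (ms_dist hn _ _) _.
    rewrite -linearB /= hA ?size_poly // => i.
    rewrite coef_rVpoly; case: insubP => [i' _ _|_]; first exact: le_sumnorm.
    by rewrite (ms0 hF) sumnorm_ge0.
  rewrite -[X in _ --> X](mulr0 A); apply: cvgM; first exact: cvg_cst.
  rewrite -[X in _ --> X](_ : \sum_(i < n) 0 = 0); last by rewrite big1.
  apply: cvg_bigsum => i; have := ul i; rewrite /tends.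
  rewrite (_ : (fun k => absF ((u k - l) 0 i)) = fun k => absF (u k 0 i - l 0 i)) //.
  by apply/funext => k; rewrite !mxE.
exists C => // g; rewrite -[sumnorm _]expr1 (le_trans (hC _)) //.
by rewrite poly_rV_K ?(size_modp_le sf) // ra_modp.
Qed.

(** Multiplication by [g] has matrix entries [O(nu g)], so its determinant is
    [O(nu g ^ n)]; applied to the powers of [g] this loses no constant. *)
Lemma normmod_le_ra g : absF (normmod n f g) <= nu g ^+ n.
Proof.
have [C C0 hC] := sumnorm_le_ra; have [D D0 hD] := normmod_le_sumnorm.
apply: (@le_of_expr_le _ _ _ (D * C ^+ n)); rewrite ?(ms_ge0 hF) ?exprn_ge0 ?(ms_ge0 hn) //.
move=> m; rewrite -(msX hF) -normmodX // (le_trans (hD _)) // -mulrA ler_wpM2l //.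
rewrite -exprM mulnC exprM -(msX hn) -exprMn lerXn2r // nnegrE ?sumnorm_ge0 //.
by rewrite mulr_ge0 ?(ms_ge0 hn) // ltW.
Qed.

End NormBound.

Section RowEquiv.
Variables (n : nat) (f : {poly F}) (nu : {poly F} -> R).
Hypotheses (sf : size f = n.+1) (hnu : residue_abs f nu).

Lemma ra_rVpoly_le : exists2 A, 0 < A &
  forall w : 'rV[F]_n, nu (rVpoly w) <= A * sumnorm w.
Proof.
have [A A0 hA] := ra_le_coef hnu n; exists (A + 1); first by lra.
move=> w; apply: le_trans (_ : A * sumnorm w <= _); last first.
  by rewrite ler_wpM2r ?sumnorm_ge0 // lerDl.
rewrite hA ?size_poly // => i.
rewrite coef_rVpoly; case: insubP => [i' _ _|_]; first exact: le_sumnorm.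
by rewrite (ms0 hF) sumnorm_ge0.
Qed.

Lemma sumnorm_le_rVpoly : exists2 C, 0 < C &
  forall w : 'rV[F]_n, sumnorm w <= C * nu (rVpoly w).
Proof.
have [C C0 hC] := sumnorm_le_ra sf hnu; exists C => // w.
by have := hC (rVpoly w); rewrite modp_small ?sf ?ltnS ?size_poly // rVpolyK.
Qed.

End RowEquiv.

(** A vector killed by such a matrix is smaller than itself. *)
Lemma unitmx_near1 n (M : 'M[F]_n) :
  (forall i k, absF ((M - 1%:M) i k) < n.+1%:R^-1) -> M \in unitmx.
Proof.
move=> hM; rewrite -row_free_unit -kermx_eq0; apply/eqP/row_matrixP => i.
set u := row i _; rewrite row0.
have uM : u *m M = 0 by apply/sub_kermxP; exact: row_sub.
have uE : u = - (u *m (M - 1%:M)) by rewrite mulmxBr mulmx1 uM sub0r opprK.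
have su : sumnorm u <= n%:R / n.+1%:R * sumnorm u.
  rewrite {1}uE /sumnorm.
  apply: (@le_trans _ _ (\sum_(k < n) \sum_i absF (u 0 i) / n.+1%:R)).
    apply: ler_sum => k _; rewrite mxE (msN hF) mxE.
    apply: le_trans (ms_sum hF _ _ _) _; apply: ler_sum => l _.
    by rewrite (msM hF) ler_wpM2l ?(ms_ge0 hF) // ltW.
  by rewrite sumr_const card_ord -mulr_suml -[leLHS]mulr_natl mulrCA [leRHS]mulrC.
have s0 : sumnorm u <= 0.
  have h : n%:R / n.+1%:R < 1 :> R by rewrite ltr_pdivrMr ?ltr0n // mul1r ltr_nat.
  have := sumnorm_ge0 u; rewrite le_eqVlt => /orP[/eqP <- //|sp].
  by move: su; rewrite -ler_pdivrMr // divff ?gt_eqF // leNgt h.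
apply/rowP => k; rewrite [RHS]mxE; apply/eqP; rewrite -(ms_eq0 _ hF).
by rewrite eq_le (ms_ge0 hF) (le_trans (le_sumnorm u k)).
Qed.

Section LocalDegree.
Variables (K : fieldExtType rat) (ev : {rmorphism {poly rat} -> K}).
Hypothesis evZ : forall c g, ev (c *: g) = c *: ev g.
Hypothesis evsurj : forall z, exists g, ev g = z.
Variables (n : nat) (f : {poly F}) (nu : {poly F} -> R) (v : K -> R).
Hypotheses (sf : size f = n.+1) (hnu : residue_abs f nu).
Hypothesis vE : forall g, v (ev g) = nu (map_poly j g).

Lemma rat_restrictionE q : rat_restriction v q = absF (j q).
Proof.
rewrite /rat_restriction -(rmorph1 ev) -evZ vE -mul_polyC mulr1.
by rewrite map_polyC (ra_cst hnu).
Qed.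

Lemma map_rVpoly (u : 'rV[rat]_n) :
  map_poly j (rVpoly u) = rVpoly (map_mx j u).
Proof.
apply/polyP => i; rewrite coef_map !coef_rVpoly.
by case: insub => [i'|]; rewrite ?mxE //; exact: rmorph0.
Qed.

Lemma ev_rVpoly (u : 'rV[rat]_n) :
  ev (rVpoly u) = \sum_i u 0 i *: ev 'X^i.
Proof.
rewrite /rVpoly poly_def rmorph_sum; apply: eq_bigr => i _.
by rewrite evZ valK.
Qed.

Lemma v_rVpoly (a : 'I_n -> rat) :
  v (\sum_i a i *: ev 'X^i) = nu (rVpoly (\row_i j (a i))).
Proof.
have -> : \sum_i a i *: ev 'X^i = ev (rVpoly (\row_i a i)).
  by rewrite ev_rVpoly; apply: eq_bigr => i _; rewrite mxE.
by rewrite vE map_rVpoly; congr (nu (rVpoly _)); apply/rowP => i; rewrite !mxE.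
Qed.

(** Coordinates modulo [f] and [nu] define the same convergence, and each
    coordinate is a limit of rational numbers. *)
Lemma power_completion_basis : completion_basis v (fun (i : 'I_n) _ => ev 'X^i).
Proof.
have hn := ra_ms hnu.
have [A A0 hA] := ra_rVpoly_le n hnu; have [C C0 hC] := sumnorm_le_rVpoly sf hnu.
split.
- move=> i e e0; exists 0%N => m k _ _.
  by rewrite subrr -(rmorph0 ev) vE rmorph0 (ms0 hn).
- move=> a _ anull i e e0.
  have [N hN] := anull (e / C) (divr_gt0 e0 C0); exists N => k Nk.
  have := hN k Nk; rewrite v_rVpoly rat_restrictionE ltr_pdivlMr // mulrC => h.
  apply: le_lt_trans h; apply: le_trans (hC _).
  by apply: le_trans (le_sumnorm _ i); rewrite mxE.
- move=> u ucauchy.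
  have [g hg] := choice (fun k => evsurj (u k)).
  have [r rE] : exists r : nat -> 'rV[F]_n,
      forall k, rVpoly (r k) = map_poly j (g k) %% f.
    exists (fun k => poly_rV (map_poly j (g k) %% f)) => k.
    by rewrite poly_rV_K ?(size_modp_le sf).
  have ap (p : nat * 'I_n) : exists q, absF (r p.1 0 p.2 - j q) < p.1.+1%:R^-1.
    by apply: (lf_dense LF); rewrite invr_gt0 ltr0n.
  have {ap}[a ha] := choice ap.
  have invn e : 0 < e -> exists N : nat, forall k, (N <= k)%N -> k.+1%:R^-1 < e :> R.
    move=> e0; exists (Num.truncn e^-1) => k Nk.
    rewrite invf_plt ?posrE ?ltr0n // (lt_le_trans (truncnS_gt _)) //.
    by rewrite ler_nat ltnS.
  have vu m k : v (u m - u k) = nu (rVpoly (r m - r k)).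
    rewrite -!hg -rmorphB vE rmorphB /= linearB /= !rE.
    by rewrite -(ra_modp hnu) modpD modpN.
  exists (fun i k => a (k, i)).
    move=> i e e0; have e3 : 0 < e / 3 by rewrite divr_gt0.
    have [N1 hN1] := invn _ e3.
    have [N2 hN2] := ucauchy (e / 3 / C) (divr_gt0 e3 C0).
    exists (maxn N1 N2) => m k; rewrite !geq_max => /andP[m1 m2] /andP[k1 k2].
    rewrite rat_restrictionE rmorphB /=.
    have -> : j (a (m, i)) - j (a (k, i)) = (r m 0 i - r k 0 i) -
      (r m 0 i - j (a (m, i))) + (r k 0 i - j (a (k, i))) by ring.
    have h1 := ha (m, i); have h2 := ha (k, i).
    have h3 := lt_trans h1 (hN1 m m1); have h4 := lt_trans h2 (hN1 k k1).
    have h5 : absF (r m 0 i - r k 0 i) < e / 3.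
      have := hN2 m k m2 k2; rewrite vu ltr_pdivlMr // mulrC.
      apply: le_lt_trans; apply: le_trans (hC _).
      by apply: le_trans (le_sumnorm _ i); rewrite !mxE.
    apply: le_lt_trans (msD hF _ _) _.
    have := msB hF (r m 0 i - r k 0 i) (r m 0 i - j (a (m, i))).
    rewrite /= in h3 h4; lra.
  move=> e e0.
  have [N hN] := invn (e / (A * n.+1%:R)) (divr_gt0 e0 (mulr_gt0 A0 (ltr0Sn _ _))).
  exists N => k Nk; rewrite -hg.
  have -> : ev (g k) - \sum_i a (k, i) *: ev 'X^i =
     ev (g k - rVpoly (\row_i a (k, i))).
    by rewrite rmorphB /= ev_rVpoly; congr (_ - _); apply: eq_bigr => i _; rewrite mxE.
  rewrite vE rmorphB /= map_rVpoly -(ra_modp hnu) modpD modpN.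
  rewrite [rVpoly _ %% f]modp_small ?sf ?ltnS ?size_poly // -rE -linearB /=.
  apply: le_lt_trans (hA _) _.
  have := hN k Nk; rewrite ltr_pdivlMr ?mulr_gt0 ?ltr0Sn // mulrCA => h.
  apply: le_lt_trans h; rewrite ler_pM2l // mulrC.
  apply: (@le_trans _ _ (\sum_(i < n) k.+1%:R^-1)).
    by apply: ler_sum => i _; rewrite !mxE; exact: ltW (ha (k, i)).
  by rewrite sumr_const card_ord -[_ *+ n]mulr_natl ler_wpM2r ?invr_ge0 ?ler0n // ler_nat.
Qed.

(** A basis of the completion expresses the powers of the generator up to an
    arbitrarily small error, so the product of two coordinate matrices of
    sizes [n * m] and [m * n] is close to the identity. *)
Lemma completion_basis_size m (b : 'I_m -> nat -> K) :
  completion_basis v b -> (n <= m)%N.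
Proof.
have hn := ra_ms hnu.
have [C C0 hC] := sumnorm_le_rVpoly sf hnu.
case=> _ _ span.
have [a] : exists a : 'I_n -> 'I_m -> nat -> rat, forall i : 'I_n,
    null_for v (fun k => ev 'X^i - \sum_(l < m) a i l k *: b l k).
  have h i : exists a : 'I_m -> nat -> rat,
      null_for v (fun k => ev 'X^i - \sum_(l < m) a l k *: b l k).
    have [|a _ ha] := span (fun=> ev 'X^(i : nat)); last by exists a.
    move=> e e0; exists 0%N => p k _ _.
    by rewrite subrr -(rmorph0 ev) vE rmorph0 (ms0 hn).
  by have [a ha] := choice (fun i : 'I_n => h i); exists a.
move=> ha.
pose e : R := n.+1%:R^-1 / C.
have e0 : 0 < e by rewrite divr_gt0 // invr_gt0 ltr0Sn.
have {ha}[N hN] := choice (fun i => ha i e e0).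
pose k := \max_i N i.
have hk (i : 'I_n) : v (ev 'X^i - \sum_(l < m) a i l k *: b l k) < e.
  by apply: hN; exact: leq_bigmax.
have [g hg] := choice (fun l => evsurj (b l k)).
pose Am : 'M[F]_(n, m) := \matrix_(i, l) j (a i l k).
pose Bm : 'M[F]_(m, n) := \matrix_(l < m) poly_rV (map_poly j (g l) %% f).
suff uAB : Am *m Bm \in unitmx.
  rewrite -[n](mxrank_unit uAB) (leq_trans (mxrankM_maxr _ _)) //.
  exact: rank_leq_row.
apply: unitmx_near1 => i l.
rewrite -(msN hF); have := hk i; rewrite ltr_pdivlMr // mulrC.
apply: le_lt_trans.
have -> : ev 'X^i - \sum_(l < m) a i l k *: b l k =
    ev ('X^i - \sum_(l < m) a i l k *: g l).
  rewrite rmorphB /= rmorph_sum /=; congr (_ - _); apply: eq_bigr => l' _.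
  by rewrite evZ hg.
rewrite vE -(ra_modp hnu); set p := _ %% f.
have pE : p = rVpoly (delta_mx 0 i - row i (Am *m Bm)).
  rewrite row_mul mulmx_sum_row linearB linear_sum /=.
  rewrite /p rmorphB modpD modpN rmorph_sum /= map_polyXn.
  rewrite modp_small ?sf ?ltnS ?size_polyXn //; congr (_ - _).
    apply/polyP => q; rewrite coefXn coef_rVpoly.
    case: insubP => [q' _ <-|]; first by rewrite mxE eqxx /=.
    by rewrite -leqNgt => nq; case: eqP => // qi; move: nq; rewrite qi leqNgt ltn_ord.
  rewrite (big_morph (fun p => p %% f) (modpD f) (mod0p f)); apply: eq_bigr => q _.
  rewrite map_polyZ modpZl rowK [in RHS]linearZ /= poly_rV_K ?(size_modp_le sf) //.
  by rewrite !mxE.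
rewrite pE; apply: le_trans (hC _); apply: le_trans (le_sumnorm _ l).
by rewrite !mxE opprB [_ == l]eq_sym.
Qed.

Lemma local_degree_ge : (n <= local_degree v)%N.
Proof.
rewrite /local_degree; case: xgetP => [m _ [b hb]|h].
  exact: completion_basis_size hb.
by case: (h n); exists (fun i _ => ev 'X^i); exact: power_completion_basis.
Qed.

End LocalDegree.

(** Rational polynomials close to [f1] are small at the first absolute value;
    if they are small at the second one too, then [f1] vanishes there. *)
Lemma residue_abs_eq f1 f2 nu1 nu2 : residue_abs f1 nu1 -> residue_abs f2 nu2 ->
  (forall g : {poly rat}, nu1 (map_poly j g) = nu2 (map_poly j g)) -> f2 %| f1.
Proof.
move=> h1 h2 h12; apply/(ra_eq0 h2).
have [A1 A10 hA1] := ra_le_coef h1 (size f1).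
have [A2 A20 hA2] := ra_le_coef h2 (size f1).
apply/eqP; rewrite eq_le (ms_ge0 (ra_ms h2)) andbT leNgt; apply/negP => n0.
pose e := nu2 f1 / (A1 + A2 + 1).
have e0 : 0 < e by rewrite divr_gt0 //; lra.
have [h [sh hh]] := poly_approx e0 (leqnn (size f1)).
set g := map_poly j h in hh.
have sg : (size (f1 - g)%R <= size f1)%N.
  rewrite (leq_trans (size_polyD _ _)) // geq_max leqnn size_polyN.
  by rewrite (leq_trans (size_poly _ _)).
have hc (i : nat) : absF ((f1 - g)`_i) <= e by rewrite coefB ltW.
have b1 := hA1 _ _ sg hc; have b2 := hA2 _ _ sg hc.
have z1 : nu1 f1 = 0 by apply/(ra_eq0 h1).
have c1 : nu1 g <= A1 * e.
  have := msB (ra_ms h1) f1 (f1 - g); rewrite subKr z1; lra.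
have c2 : nu2 f1 <= nu2 (f1 - g) + nu2 g.
  by have := msD (ra_ms h2) (f1 - g) g; rewrite subrK.
have : nu2 f1 <= (A1 + A2) * e by rewrite -h12 -/g in c2; lra.
have -> : (A1 + A2) * e = nu2 f1 - e by rewrite /e; field; lra.
lra.
Qed.

End Field.
End LocalField.

(** * Extension of ultrametric absolute values *)

Lemma irreducible_coprimep (F : fieldType) (f g : {poly F}) :
  irreducible_poly f -> coprimep f g = ~~ (f %| g).
Proof.
move=> irr; have sf := irr.1; apply/idP/idP => [cop|nfg].
  apply/negP => fg; move: cop; rewrite /coprimep.
  by rewrite (eqp_size (dvdp_gcd_idl fg)) => /eqP sf1; rewrite sf1 in sf.
rewrite /coprimep; apply/negPn/negP => /irr.2 /(_ (dvdp_gcdl f g)) h.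
by move: nfg; rewrite -(eqp_dvdl g h) dvdp_gcdr.
Qed.

Section NonArchimedean.
Variable R : realType.
Variable U : set_system nat.
Hypothesis UU : free_ultrafilter U.
Variables (F : fieldType) (absF : F -> R) (j : {rmorphism rat -> F}).
Hypothesis LF : local_field U absF j.
Hypothesis ultraF : forall x y, absF (x + y) <= Num.max (absF x) (absF y).
Let hF := lf_abs LF.

Variables (n : nat) (f : {poly F}).
Hypotheses (sf : size f = n.+2) (irrf : irreducible_poly f).
Let N g := absF (normmod n.+1 f g).

Let N_ge0 g : 0 <= N g. Proof. exact: ms_ge0 hF _. Qed.
Let NM g h : N (g * h) = N g * N h.
Proof. by rewrite /N (normmodM sf) (msM hF). Qed.
Let NX g m : N (g ^+ m) = N g ^+ m.
Proof. by rewrite /N (normmodX sf) (msX hF). Qed.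
Let N1 : N 1 = 1.
Proof. by rewrite -(expr0 0) NX expr0. Qed.
Let NDM g q : N (g + q * f) = N g.
Proof. by rewrite /N -normmod_modp modpD modp_mull addr0 normmod_modp. Qed.
Let N0 : N 0 = 0.
Proof. by rewrite /N -(polyC0 F) (normmodC sf) expr0n (ms0 hF). Qed.

Let N_eq0 g : (N g == 0) = (f %| g).
Proof.
rewrite /N (ms_eq0 _ hF); apply/idP/idP => [|fg].
  apply: contraTT => nfg; apply: (normmod_neq0 sf).
  by rewrite irreducible_coprimep.
by have := N0; rewrite -normmod_modp (modp_eq0P _ _ fg) => /eqP; rewrite (ms_eq0 _ hF).
Qed.

(** Compactness replaces Hensel's lemma: the norm dominates the coordinates, so
    the powers of [g] stay bounded; by the binomial formula so do the powers of
    [1 + g], and then the powers of its norm. *)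
Lemma norm1D_le1 g : N g <= 1 -> N (1 + g) <= 1.
Proof.
move=> Ng.
have [C C0 hC] : exists2 C, 0 < C & forall u : 'rV[F]_n.+1,
    sumnorm absF u ^+ n.+1 <= C * N (rVpoly u).
  apply: (homogeneous_lower_bound UU LF) => [c u|u u0|u l ul].
  - by rewrite linearZ /= -mul_polyC NM {1}/N (normmodC sf) (msX hF).
  - rewrite lt_def N_ge0 N_eq0 andbT; apply: contra u0 => fu.
    have := modp_eq0P _ _ fu; rewrite modp_small ?sf ?ltnS ?size_poly // => h.
    by rewrite -(rVpolyK u) h linear0.
  - exact: (tends_abs UU LF) (tends_normmod UU LF _ ul).
pose B := C + 1.
have B1 : 1 <= B by rewrite /B; lra.
have bnd k : sumnorm absF (poly_rV (g ^+ k %% f) : 'rV_n.+1) <= B.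
  set s := sumnorm _ _; rewrite leNgt; apply/negP => Bs.
  have : s ^+ n.+1 <= C.
    rewrite (le_trans (hC _)) // poly_rV_K ?(size_modp_le sf) //.
    rewrite /N normmod_modp -/(N _) NX -[leRHS]mulr1 ler_pM2l //.
    by rewrite exprn_ile1.
  rewrite leNgt => /negP; apply; apply: (@lt_le_trans _ _ B); first by rewrite /B; lra.
  by rewrite (le_trans (ltW Bs)) // exprS ler_peMr ?exprn_ege1 //; lra.
have [D D0 hD] := normmod_le_sumnorm LF sf.
apply: (@le_of_expr_le _ _ _ (D * (n.+1%:R * B) ^+ n.+1)) => // m.
rewrite expr1n mulr1 -NX (le_trans (hD _)) // ler_wpM2l //.
rewrite lerXn2r ?nnegrE ?(sumnorm_ge0 LF) ?mulr_ge0 ?ler0n //; first by lra.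
apply: (@le_trans _ _ (\sum_(i < n.+1) B)); last first.
  by rewrite sumr_const card_ord mulr_natl.
apply: ler_sum => i _; rewrite mxE exprDn.
rewrite (big_morph (fun p => p %% f) (modpD f) (mod0p f)) coef_sum.
apply: (ultra_sum hF _ ultraF) => [|k _]; first by lra.
rewrite expr1n mul1r.
have -> : (g ^+ k *+ 'C(m, k)) %% f = (g ^+ k %% f) *+ 'C(m, k).
  elim: 'C(m, k) => [|c IH]; first by rewrite !mulr0n mod0p.
  by rewrite !mulrS modpD IH.
apply: (@le_trans _ _ (absF (g ^+ k %% f)`_i)).
  rewrite coefMn; elim: 'C(m, k) => [|c IH]; first by rewrite mulr0n (ms0 hF) (ms_ge0 hF).
  by rewrite mulrS (le_trans (ultraF _ _)) // ge_max lexx.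
by apply: le_trans (bnd k); apply: le_trans (le_sumnorm LF _ i); rewrite mxE.
Qed.

(** Division modulo [f] by the larger of the two reduces to [norm1D_le1]. *)
Lemma norm_ultra g h : N (g + h) <= Num.max (N g) (N h).
Proof.
wlog gh : g h / N g <= N h.
  move=> W; case/orP: (le_total (N g) (N h)) => [/W //|/W].
  by rewrite addrC maxC.
apply: (@le_trans _ _ (N h)); last by rewrite le_max lexx orbT.
have [/eqP h0|hn0] := boolP (N h == 0).
  have g0 : N g = 0 by apply/eqP; rewrite eq_le N_ge0 -h0 gh.
  rewrite h0; have /eqP -> // : N (g + h) == 0.
  by rewrite N_eq0 dvdp_add // -N_eq0 ?g0 ?h0.
have : coprimep f h by rewrite irreducible_coprimep // -N_eq0.
case/Bezout_eq1_coprimepP => -[u w] /= uw.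
have hw : w * h = 1 + (- u) * f by rewrite -uw; ring.
have Nhw : N w * N h = 1 by rewrite -NM hw NDM N1.
have -> : N (g + h) = N h * N (1 + g * w).
  rewrite -NM -(NDM (g + h) (- (u * g))); congr N.
  by rewrite mulrDr mulr1 mulrCA [h * w]mulrC hw; ring.
rewrite ler_piMr ?N_ge0 // norm1D_le1 // NM.
by rewrite -Nhw mulrC ler_wpM2l ?N_ge0.
Qed.

Lemma residue_abs_ultra_exists : exists nu : {poly F} -> R,
  residue_abs absF f nu /\ forall g h, nu (g + h) <= Num.max (nu g) (nu h).
Proof.
pose e : R := n.+1%:R^-1.
have e0 : 0 < e by rewrite invr_gt0 ltr0n.
pose nu g := N g `^ e.
have nuU g h : nu (g + h) <= Num.max (nu g) (nu h).
  rewrite le_max; have := norm_ultra g h; rewrite le_max => /orP[] le1;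
    apply/orP; [left|right].
    by rewrite ge0_ler_powR ?nnegrE ?N_ge0 // ltW.
  by rewrite ge0_ler_powR ?nnegrE ?N_ge0 // ltW.
exists nu; split => //; split.
- split.
  + by move=> x; rewrite powR_ge0.
  + by rewrite /nu N0 powR0 ?gt_eqF.
  + by rewrite /nu N1 powR1.
  + by move=> x y; rewrite /nu NM powRM.
  + move=> x y; apply: le_trans (nuU x y) _; rewrite ge_max.
    by rewrite lerDl lerDr !powR_ge0.
- move=> c; rewrite /nu /N (normmodC sf) (msX hF) -powR_mulrn ?(ms_ge0 hF) //.
  by rewrite -powRrM mulfV ?pnatr_eq0 // powRr1 ?(ms_ge0 hF).
- move=> g; rewrite -N_eq0; split => [/powR_eq0_eq0 -> //|/eqP g0].
  by rewrite /nu g0 powR0 ?gt_eqF.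
Qed.

End NonArchimedean.

(** * Completion of the rational numbers *)

Section UltraCompletion.
Variable R : realType.
Variable U : set_system nat.
Hypothesis UU : free_ultrafilter U.
Let Upf : ProperFilter U := @ultra_proper _ _ (proj1 UU).
Let Uf : Filter U := @filter_filter _ _ Upf.
#[local] Existing Instance Upf.
#[local] Existing Instance Uf.

Variable w : rat -> R.
Hypothesis hw : mult_seminorm w.
Hypothesis w_precompact : forall (x : nat -> rat) (B e : R), 0 < e ->
  (forall k, w (x k) <= B) -> exists c, U [set k | w (x k - c) < e].

(** The field is the quotient of the bounded sequences by those that tend to 0
    along the ultrafilter.  Bounded sequences serve better than Cauchy
    sequences, as the class of a sequence of approximations is at once an
    ultralimit. *)
Definition bounded_seqs : {pred nat -> rat} :=
  fun x => `[< exists B, forall k, w (x k) <= B >].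

Lemma bounded_seqsP x :
  reflect (exists B, forall k, w (x k) <= B) (x \in bounded_seqs).
Proof. exact: asboolP. Qed.

Lemma bounded_subring : subring_closed bounded_seqs.
Proof.
split.
- by apply/bounded_seqsP; exists 1 => k; rewrite (ms1 hw).
- move=> x y /bounded_seqsP[B hB] /bounded_seqsP[C hC].
  apply/bounded_seqsP; exists (B + C) => k.
  by apply: le_trans (msB hw _ _) _; rewrite lerD.
- move=> x y /bounded_seqsP[B hB] /bounded_seqsP[C hC].
  apply/bounded_seqsP; exists (B * C) => k; rewrite (msM hw).
  by rewrite ler_pM ?(ms_ge0 hw).
Qed.

HB.instance Definition _ :=
  GRing.isSubringClosed.Build (nat -> rat) bounded_seqs bounded_subring.

Record bseq := Bseq { bval :> nat -> rat; _ : bval \in bounded_seqs }.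
HB.instance Definition _ := [isSub for bval].
HB.instance Definition _ := [Choice of bseq by <:].
HB.instance Definition _ := [SubChoice_isSubComNzRing of bseq by <:].

Lemma bseq_bound (x : bseq) : exists B, forall k, w (bval x k) <= B.
Proof. exact/bounded_seqsP/(valP x). Qed.

Lemma wlim_exists (x : bseq) : exists l : R, w \o bval x @ U --> l.
Proof.
have [B hB] := bseq_bound x.
apply: (real_ultralimit UU) (B) _ => k /=.
by rewrite ger0_norm ?(ms_ge0 hw).
Qed.

Definition wlim (x : bseq) : R := sval (cid (wlim_exists x)).

Lemma wlimP (x : bseq) : w \o bval x @ U --> wlim x.
Proof. exact: svalP (cid (wlim_exists x)). Qed.

Arguments wlimP x : clear implicits.

Lemma wlim_eq (x : bseq) (l : R) : w \o bval x @ U --> l -> wlim x = l.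
Proof. by move=> h; exact: (cvg_unique (@norm_hausdorff _ R) (wlimP x) h). Qed.

Lemma wlim_ms : mult_seminorm wlim.
Proof.
split.
- move=> x; apply: (@cvgr_to_ge _ U _ _ (w \o bval x) _ _ (wlimP x)).
  by near=> k; exact: (ms_ge0 hw).
- by apply: wlim_eq; rewrite (_ : _ \o _ = cst 0); [exact: cvg_cst|];
    apply/funext => k /=; rewrite (ms0 hw).
- by apply: wlim_eq; rewrite (_ : _ \o _ = cst 1); [exact: cvg_cst|];
    apply/funext => k /=; rewrite (ms1 hw).
- move=> x y; apply: wlim_eq.
  rewrite (_ : _ \o _ = (fun k => w (bval x k) * w (bval y k))).
    by apply: cvgM; exact: wlimP.
  by apply/funext => k /=; rewrite (msM hw).
- move=> x y.
  have h : (fun k => w (bval x k) + w (bval y k)) @ U --> wlim x + wlim y.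
    by apply: cvgD; exact: wlimP.
  apply: (ler_cvg_to (wlimP (x + y)) h).
  by near=> k; exact: (msD hw).
Unshelve. all: by end_near. Qed.

Definition null_seqs : {pred bseq} := fun x => wlim x == 0.

Lemma null_ideal : idealr_closed null_seqs.
Proof.
split.
- by rewrite unfold_in (ms0 wlim_ms).
- by rewrite unfold_in (ms1 wlim_ms) oner_eq0.
- move=> a x y; rewrite !unfold_in => /eqP x0 /eqP y0.
  rewrite eq_le (ms_ge0 wlim_ms) andbT.
  by rewrite (le_trans (msD wlim_ms _ _)) // (msM wlim_ms) x0 y0 mulr0 addr0.
Qed.

HB.instance Definition _ := isIdealr.Build bseq null_seqs null_ideal.

Local Open Scope quotient_scope.

Local Notation ucompl := {ideal_quot null_seqs}.
Local Notation repr := generic_quotient.repr.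

Lemma wlim_near0 (x : bseq) : U [set k | bval x k = 0] -> wlim x = 0.
Proof.
move=> x0; apply: wlim_eq; apply: cvg_near_cst.
by apply: filterS x0 => k /= ->; rewrite (ms0 hw).
Qed.

Lemma ucompl_repr (a : bseq) : repr (\pi_ucompl a) - a \in null_seqs.
Proof. by rewrite Quotient.idealrBE reprK. Qed.

(** A sequence that does not tend to 0 is bounded below on a set of the
    ultrafilter, where it can be inverted term by term. *)
Lemma ucompl_inv (x : ucompl) : x != 0 -> exists y, y * x = 1.
Proof.
rewrite -[x]reprK; set a := repr x => pa0.
have la : 0 < wlim a.
  rewrite lt_def (ms_ge0 wlim_ms) andbT; apply: contra pa0 => a0.
  have : a - 0 \in null_seqs by rewrite subr0.
  by rewrite Quotient.idealrBE => /eqP ->; rewrite rmorph0.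
pose l := wlim a / 2; have l0 : 0 < l by rewrite divr_gt0.
have Ul : U [set k | l < w (bval a k)].
  by apply: (cvgr_gt (wlim a) (wlimP a)); rewrite /l; lra.
pose bs k := if l < w (bval a k) then (bval a k)^-1 else 0.
have bsP : bs \in bounded_seqs.
  apply/bounded_seqsP; exists l^-1 => k; rewrite /bs; case: ifPn => [h|_].
    by rewrite (msV _ hw) lef_pV2 ?posrE ?(lt_trans l0 h) // ltW.
  by rewrite (ms0 hw) invr_ge0 ltW.
pose b := Bseq bsP.
exists (\pi_ucompl b); rewrite -(rmorphM \pi_ucompl) -(rmorph1 \pi_ucompl).
apply/eqP; rewrite -Quotient.idealrBE; apply/eqP; apply: wlim_near0.
apply: filterS Ul => k /= lk; rewrite /GRing.add /GRing.mul /= /bs lk mulVf ?subrr //.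
by rewrite -(ms_eq0 _ hw) gt_eqF // (lt_trans l0).
Qed.

Definition ufield : Type := ucompl.
HB.instance Definition _ := GRing.ComNzRing.on ufield.

Definition uinv (x : ufield) : ufield :=
  if pselect (x != 0) is left x0 then sval (cid (ucompl_inv x0)) else 0.

Lemma uinvVf x : x != 0 -> uinv x * x = 1.
Proof.
by rewrite /uinv; case: pselect => // x0 _; exact: svalP (cid (ucompl_inv x0)).
Qed.

Lemma uinv0 : uinv 0 = 0.
Proof. by rewrite /uinv; case: pselect => // x0; have := x0; rewrite eqxx. Qed.

HB.instance Definition _ := GRing.ComNzRing_isField.Build ufield uinvVf uinv0.

Definition uabs (x : ufield) : R := wlim (repr x).

Lemma uabs_pi (a : bseq) : uabs (\pi_ucompl a) = wlim a.
Proof.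
apply/eqP; rewrite -subr_eq0 -normr_le0.
rewrite (le_trans (ms_dist wlim_ms _ _)) // le_eqVlt; apply/orP; left.
exact: ucompl_repr.
Qed.

Lemma uabs_ms : mult_seminorm uabs.
Proof.
split.
- by move=> x; exact: (ms_ge0 wlim_ms).
- by rewrite -[0](rmorph0 \pi_ucompl) uabs_pi (ms0 wlim_ms).
- by rewrite -[1](rmorph1 \pi_ucompl) uabs_pi (ms1 wlim_ms).
- move=> x y; rewrite -[x]reprK -[y]reprK.
  by rewrite -[_ * _](rmorphM \pi_ucompl) !uabs_pi (msM wlim_ms).
- move=> x y; rewrite -[x]reprK -[y]reprK.
  by rewrite -[_ + _](rmorphD \pi_ucompl) !uabs_pi (msD wlim_ms).
Qed.

Lemma cst_bounded q : (fun=> q) \in bounded_seqs.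
Proof. by apply/bounded_seqsP; exists (w q). Qed.

Definition cst_bseq q : bseq := Bseq (cst_bounded q).

Definition uinj (q : rat) : ufield := \pi_ucompl (cst_bseq q).

Lemma uinj_zmod : zmod_morphism uinj.
Proof. by move=> x y; rewrite /uinj -[RHS](rmorphB \pi_ucompl); congr \pi; exact: val_inj. Qed.

Lemma uinj_monoid : monoid_morphism uinj.
Proof.
split; first by rewrite /uinj -[RHS](rmorph1 \pi_ucompl); congr \pi; exact: val_inj.
by move=> x y; rewrite /uinj -[RHS](rmorphM \pi_ucompl); congr \pi; exact: val_inj.
Qed.

HB.instance Definition _ := GRing.isZmodMorphism.Build rat ufield uinj uinj_zmod.
HB.instance Definition _ := GRing.isMonoidMorphism.Build rat ufield uinj uinj_monoid.

Lemma uabs_inj q : uabs (uinj q) = w q.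
Proof.
rewrite uabs_pi; apply: wlim_eq.
by rewrite (_ : _ \o _ = cst (w q)) //; exact: cvg_cst.
Qed.

Lemma uabs_le_near (a b : bseq) (e : R) :
  U [set k | w (bval a k - bval b k) <= e] -> uabs (\pi_ucompl a - \pi_ucompl b) <= e.
Proof.
move=> h; rewrite -(rmorphB \pi_ucompl) uabs_pi.
exact: (cvgr_to_le (wlimP (a - b)) h).
Qed.

Lemma ufield_dense x (e : R) : 0 < e -> exists q, uabs (x - uinj q) < e.
Proof.
move=> e0; rewrite -[x]reprK; set a := repr x.
have [B hB] := bseq_bound a.
have e2 : 0 < e / 2 by rewrite divr_gt0.
have [c hc] := w_precompact e2 hB; exists c.
apply: le_lt_trans (_ : e / 2 < e); last by lra.
by apply: uabs_le_near; apply: filterS hc => k /= /ltW.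
Qed.

(** The limit is the class of a sequence of rational approximations: both stay
    close to the same rational constant [c]. *)
Lemma ufield_ultralimit (x : nat -> ufield) (B : R) :
  (forall k, uabs (x k) <= B) ->
  exists l, (fun k => uabs (x k - l)) @ U --> (0 : R).
Proof.
move=> xB.
have invp k : 0 < k.+1%:R^-1 :> R by rewrite invr_gt0.
have [q hq] := choice (fun k => ufield_dense (x k) (invp k)).
have qB k : w (q k) <= B + 1.
  rewrite -uabs_inj -[uinj _](subKr (x k)) (le_trans (msB uabs_ms _ _)) //.
  by rewrite lerD // (le_trans (ltW (hq k))) // invf_le1 ?ler1n.
have qP : q \in bounded_seqs by apply/bounded_seqsP; exists (B + 1).
pose l : ufield := \pi_ucompl (Bseq qP).
exists l; apply/cvgr0Pnorm_le => e e0; have e3 : 0 < e / 3 by rewrite divr_gt0.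
have [c hc] := w_precompact e3 qB.
have lc : uabs (l - uinj c) <= e / 3.
  by apply: uabs_le_near; apply: filterS hc => k /= /ltW.
have hk : U [set k | k.+1%:R^-1 < e / 3].
  apply: (proj2 UU).
  exact: (cvgr_lt (0 : R) (@cvg_harmonic R) _ e3).
near=> k; rewrite ger0_norm ?(ms_ge0 uabs_ms) //.
have -> : x k - l = (x k - uinj (q k)) + (uinj (q k - c) - (l - uinj c)).
  by rewrite rmorphB /=; ring.
apply: le_trans (msD uabs_ms _ _) _.
have h1 : uabs (x k - uinj (q k)) < e / 3.
  by apply: lt_trans (hq k) _; near: k.
have h2 : uabs (uinj (q k - c)) < e / 3 by rewrite uabs_inj; near: k.
have := msB uabs_ms (uinj (q k - c)) (l - uinj c); lra.
Unshelve. all: by end_near. Qed.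

Lemma ufield_local : local_field U uabs uinj.
Proof.
by split; [exact: uabs_ms|exact: ufield_dense|exact: ufield_ultralimit].
Qed.

Lemma local_field_exists : exists (F : fieldType) (absF : F -> R)
    (j : {rmorphism rat -> F}),
  local_field U absF j /\ forall q, absF (j q) = w q.
Proof.
exists ufield, uabs, uinj; split; [exact: ufield_local|exact: uabs_inj].
Qed.

End UltraCompletion.

(** The strict inequality passes from the dense rationals to the field. *)
Lemma local_field_ultra (R : realType) U (F : fieldType) (absF : F -> R)
    (j : {rmorphism rat -> F}) : local_field U absF j ->
  (forall p q, absF (j (p + q)) <= Num.max (absF (j p)) (absF (j q))) ->
  forall x y, absF (x + y) <= Num.max (absF x) (absF y).
Proof.
move=> LF uj x y; have hF := lf_abs LF.
rewrite leNgt; apply/negP; rewrite gt_max => /andP[hx hy].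
pose e := Num.min (absF (x + y) - absF x) (absF (x + y) - absF y) / 4.
have e0 : 0 < e by rewrite divr_gt0 // lt_min !subr_gt0 hx hy.
have [p hp] := lf_dense LF x e0; have [q hq] := lf_dense LF y e0.
have ex : e * 4 <= absF (x + y) - absF x.
  by rewrite /e divfK ?pnatr_eq0 // ge_min lexx.
have ey : e * 4 <= absF (x + y) - absF y.
  by rewrite /e divfK ?pnatr_eq0 // ge_min lexx orbT.
have px : absF (j p) <= absF x + absF (x - j p).
  by have := msB hF x (x - j p); rewrite subKr.
have qy : absF (j q) <= absF y + absF (y - j q).
  by have := msB hF y (y - j q); rewrite subKr.
have := uj p q; rewrite rmorphD.
have xy : absF (x + y) <= absF (j p + j q) + (absF (x - j p) + absF (y - j q)).
  have -> : x + y = (j p + j q) + ((x - j p) + (y - j q)) by ring.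
  by rewrite (le_trans (msD hF _ _)) // lerD2l (msD hF).
rewrite le_max => /orP[]; lra.
Qed.

(** * The p-adic absolute value on the rationals *)

Section Padic.
Variables (R : realType) (p : nat).
Hypothesis pp : prime p.
Local Notation w := (padic_abs R p).

Let p_gt0 : 0 < p%:R :> R. Proof. by rewrite ltr0n prime_gt0. Qed.
Let p_neq0 : p%:R != 0 :> R. Proof. by rewrite gt_eqF. Qed.
Let p_gt1 : 1 < p%:R :> R. Proof. by rewrite ltr1n prime_gt1. Qed.

Lemma padic_abs_frac (a b : int) : a != 0 -> b != 0 ->
  w (a%:~R / b%:~R) = p%:R ^ ((logn p `|b|)%:Z - (logn p `|a|)%:Z).
Proof.
move=> a0 b0; set q := a%:~R / b%:~R.
have q0 : q != 0 by rewrite mulf_neq0 ?invr_eq0 ?intr_eq0.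
rewrite /padic_abs (negPf q0); congr (_ ^ _).
have E : a * denq q = numq q * b.
  apply: (@intr_inj rat); rewrite !rmorphM /=.
  have d0 : (denq q)%:~R != 0 :> rat by rewrite intr_eq0 denq_neq0.
  have b0' : b%:~R != 0 :> rat by rewrite intr_eq0.
  have := divq_num_den q => h.
  rewrite -[X in X * b%:~R](divfK d0) h /q.
  by field.
have := congr1 (fun z => logn p `|z|%N) E.
rewrite !abszM !lognM ?absz_gt0 ?denq_neq0 ?numq_eq0 //.
move=> h; apply/eqP; rewrite subr_eq addrAC eq_sym subr_eq -!PoszD addnC.
by rewrite -h addnC.
Qed.

Lemma padic_abs0 : w 0 = 0.
Proof. by rewrite /padic_abs eqxx. Qed.

Lemma padic_abs_ge0 q : 0 <= w q.
Proof. by rewrite /padic_abs; case: eqP => // _; rewrite exprz_ge0 // ltW. Qed.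

Lemma padic_abs_int (z : int) : z != 0 -> w z%:~R = p%:R ^- logn p `|z|.
Proof.
move=> z0; rewrite -[z%:~R]divr1 -[1]/(1%:~R) padic_abs_frac // logn1 sub0r.
by rewrite -exprnN.
Qed.

Lemma padic_absM q r : w (q * r) = w q * w r.
Proof.
have [->|q0] := eqVneq q 0; first by rewrite mul0r padic_abs0 mul0r.
have [->|r0] := eqVneq r 0; first by rewrite mulr0 padic_abs0 mulr0.
have E : q * r = (numq q * numq r)%:~R / (denq q * denq r)%:~R.
  by rewrite -{1}(divq_num_den q) -{1}(divq_num_den r) !rmorphM /= invfM mulrACA.
rewrite E padic_abs_frac ?mulf_neq0 ?numq_eq0 ?denq_neq0 //.
rewrite !abszM !lognM ?absz_gt0 ?numq_eq0 ?denq_neq0 //.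
rewrite /padic_abs (negPf q0) (negPf r0) -expfzDr //; congr (_ ^ _).
by rewrite !PoszD opprD addrACA.
Qed.

Lemma padic_abs1 : w 1 = 1.
Proof. by rewrite -[1]/(1%:~R) padic_abs_int // logn1 expr0 invr1. Qed.

Lemma padic_abs_int_le1 (z : int) : w z%:~R <= 1.
Proof.
have [->|z0] := eqVneq z 0; first by rewrite padic_abs0.
by rewrite padic_abs_int // invf_le1 ?exprn_gt0 // exprn_ege1 // ltW.
Qed.

Lemma padic_abs_unit (z : int) : ~~ (p %| `|z|)%N -> w z%:~R = 1.
Proof.
move=> pz; have z0 : z != 0 by apply: contraNneq pz => ->; rewrite dvdn0.
by rewrite padic_abs_int // lognE (negPf pz) !andbF expr0 invr1.
Qed.

Lemma padic_le1_denq q : w q <= 1 -> ~~ (p %| `|denq q|)%N.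
Proof.
move=> wq; apply/negP => pd; move: wq; apply/negP; rewrite -ltNge.
have pn : ~~ (p %| `|numq q|)%N.
  apply/negP => pn; have := coprime_num_den q; rewrite /coprime => /eqP h.
  have : (p %| 1)%N by rewrite -h dvdn_gcd pn pd.
  by rewrite dvdn1 => /eqP p1; move: pp; rewrite p1.
have q0 : q != 0 by apply: contraNneq pn => ->; rewrite dvdn0.
rewrite /padic_abs (negPf q0) [logn p `|numq q|]lognE (negPf pn) !andbF subr0.
by rewrite exprn_egt1 // -lt0n logn_gt0 mem_primes pp absz_gt0 denq_neq0.
Qed.

(** After division by the larger term, a fraction [t] without [p] in its
    denominator remains so when 1 is added. *)
Lemma padic_abs_ultra x y : w (x + y) <= Num.max (w x) (w y).
Proof.
wlog xy : x y / w x <= w y.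
  move=> W; case/orP: (le_total (w x) (w y)) => [/W //|/W].
  by rewrite addrC maxC.
apply: (@le_trans _ _ (w y)); last by rewrite le_max lexx orbT.
have [y0|y0] := eqVneq y 0; first by move: xy; rewrite y0 addr0.
pose t := x / y.
have xE : x = t * y by rewrite divfK.
have wy : 0 < w y.
  by rewrite /padic_abs (negPf y0) exprz_gt0.
have wt : w t <= 1 by move: xy; rewrite xE padic_absM -ler_pdivlMr // divff // gt_eqF.
have -> : x + y = (t + 1) * y by rewrite mulrDl mul1r -xE.
rewrite padic_absM ler_piMl ?(ltW wy) //.
have d0 : (denq t)%:~R != 0 :> rat by rewrite intr_eq0 denq_neq0.
have h : w (t + 1) * w (denq t)%:~R <= 1.
  rewrite -padic_absM mulrDl mul1r -{1}(divq_num_den t) divfK // -rmorphD.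
  exact: padic_abs_int_le1.
by move: h; rewrite padic_abs_unit ?mulr1 ?padic_le1_denq.
Qed.

Lemma padic_abs_ms : mult_seminorm w.
Proof.
split; [exact: padic_abs_ge0|exact: padic_abs0|exact: padic_abs1|exact: padic_absM|].
move=> x y; rewrite (le_trans (padic_abs_ultra x y)) // ge_max.
by rewrite lerDl lerDr !padic_abs_ge0.
Qed.

Lemma padic_abs_p : w p%:R = p%:R^-1.
Proof.
rewrite -[p%:R]/(p%:Z%:~R) padic_abs_int; last by rewrite eqz_nat -lt0n prime_gt0.
by rewrite absz_nat logn_prime // eqxx expr1.
Qed.

(** Residues modulo a power of [p] are represented by finitely many
    integers. *)
Lemma padic_residue x E : w x <= 1 ->
  exists c : 'I_(p ^ E), w (x - (c : nat)%:R) <= p%:R ^- E.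
Proof.
move=> wx; have pd := padic_le1_denq wx.
have pE0 : (0 < p ^ E)%N by rewrite expn_gt0 prime_gt0.
have cop : coprimez (denq x) (p ^ E)%N.
  by rewrite /coprimez /gcdz absz_nat -[_ == _]/(coprime _ _) coprimeXr //
    coprime_sym prime_coprime.
have [[u v] /= uv] := coprimezP _ _ cop.
pose z := (numq x * u)%R.
have zlt : (`|(z %% (p ^ E)%N)%Z| < p ^ E)%N.
  by rewrite -ltz_nat gez0_abs ?modz_ge0 ?ltz_pmod ?eqz_nat -?lt0n.
exists (Ordinal zlt) => /=.
have d0 : (denq x)%:~R != 0 :> rat by rewrite intr_eq0 denq_neq0.
have wd : w (denq x)%:~R = 1 by exact: padic_abs_unit.
have -> : (`|(z %% (p ^ E)%N)%Z|%N)%:R = (z %% (p ^ E)%N)%Z%:~R :> rat.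
  by rewrite -[LHS]/((`|(z %% (p ^ E)%N)%Z|%N)%:Z%:~R) gez0_abs // modz_ge0 // eqz_nat -lt0n.
rewrite -[w _]mulr1 -{1}wd -padic_absM.
have -> : (x - (z %% (p ^ E)%N)%Z%:~R) * (denq x)%:~R =
   p%:R ^+ E * (numq x * v + (z %/ (p ^ E)%N)%Z * denq x)%:~R.
  rewrite mulrBl -{1}(divq_num_den x) divfK //.
  have -> : p%:R ^+ E = ((p ^ E)%N : int)%:~R :> rat by rewrite -natrX.
  rewrite -!rmorphM -rmorphB /=; congr (_%:~R).
  have zE := divz_eq z (p ^ E)%N.
  set m := (z %% _)%Z in zE *; set t := (z %/ _)%Z in zE *.
  have -> : m = z - t * (p ^ E)%N by rewrite zE addrC addKr.
  rewrite -{1}[numq x]mulr1 -uv /z; ring.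
rewrite padic_absM (msX padic_abs_ms) padic_abs_p exprVn ler_piMr
  ?invr_ge0 ?exprn_ge0 ?(ltW p_gt0) //.
exact: padic_abs_int_le1.
Qed.

Lemma lt_prime_power (B : R) : exists M, B < p%:R ^+ M.
Proof.
exists (Num.truncn B).+1; apply: lt_trans (truncnS_gt B) _.
by rewrite -natrX ltr_nat ltn_expl // prime_gt1.
Qed.

(** Among finitely many residues, one is taken on a set of the ultrafilter. *)
Lemma padic_precompact U : free_ultrafilter U ->
  forall (x : nat -> rat) (B e : R), 0 < e -> (forall k, w (x k) <= B) ->
  exists c, U [set k | w (x k - c) < e].
Proof.
move=> UU x B e e0 xB.
have hw := padic_abs_ms.
have Upf : ProperFilter U := @ultra_proper _ _ (proj1 UU).
have Uf : Filter U := @filter_filter _ _ Upf.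
have [M hM] := lt_prime_power B; have [E hE] := lt_prime_power e^-1.
have pM0 : p%:R ^+ M != 0 :> rat by rewrite expf_neq0 // pnatr_eq0 -lt0n prime_gt0.
have wpM : w (p%:R ^+ M) = p%:R ^- M by rewrite (msX hw) padic_abs_p exprVn.
have small k : w (x k * p%:R ^+ M) <= 1.
  rewrite (msM hw) wpM ler_pdivrMr ?exprn_gt0 // mul1r.
  exact: le_trans (xB k) (ltW hM).
have [c hc] := choice (fun k => padic_residue (M + E) (small k)).
have [i Ui] : exists i, U [set k | c k = i].
  apply: contrapT => nU.
  have : U [set k | forall i, c k <> i].
    apply: filter_forall => i.
    by have [h|//] := in_ultra_setVsetC [set k | c k = i] (proj1 UU); case: nU; exists i.
  by case/filter_ex => k /(_ (c k)).
exists ((i : nat)%:R / p%:R ^+ M); apply: filterS Ui => k /= ki.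
have -> : x k - i%:R / p%:R ^+ M = (x k * p%:R ^+ M - i%:R) / p%:R ^+ M.
  by rewrite mulrBl mulfK.
rewrite (msM hw) (msV _ hw) wpM invrK -ki.
apply: (@le_lt_trans _ _ (p%:R ^- (M + E) * p%:R ^+ M)).
  by rewrite ler_pM2r ?exprn_gt0 // hc.
rewrite exprD invfM mulrAC mulVf ?expf_neq0 // mul1r.
by rewrite invf_plt ?posrE ?exprn_gt0.
Qed.

Lemma padic_field_exists U : free_ultrafilter U ->
  exists (F : fieldType) (absF : F -> R) (j : {rmorphism rat -> F}),
  [/\ local_field U absF j, forall q, absF (j q) = w q &
      forall x y, absF (x + y) <= Num.max (absF x) (absF y)].
Proof.
move=> UU.
have [F [absF [j [LF jw]]]] :=
  local_field_exists UU padic_abs_ms (padic_precompact UU).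
exists F, absF, j; split => //; apply: (local_field_ultra LF) => q r.
by rewrite !jw padic_abs_ultra.
Qed.

End Padic.

Lemma real_local_field (R : realType) U : free_ultrafilter U ->
  local_field U (fun x : R => `|x|) (@ratr R).
Proof.
move=> UU; split.
- by split; [exact: normr_ge0|exact: normr0|exact: normr1|exact: normrM|exact: ler_normD].
- move=> x e e0; have /rat_in_itvoo[q] : x - e < x + e by lra.
  rewrite in_itv /= => /andP[h1 h2]; exists q.
  by rewrite ltr_norml; apply/andP; split; lra.
- move=> x B xB; have [l hl] := real_ultralimit UU xB; exists l.
  have Upf : ProperFilter U := @ultra_proper _ _ (proj1 UU).
  by apply/norm_cvg0P/subr_cvg0.
Qed.

(** * Places above a local field *)

Lemma irreducible_factor (F : fieldType) (g : {poly F}) : (1 < size g)%N ->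
  exists2 f, irreducible_poly f & f %| g.
Proof.
have [n] := ubnP (size g); elim: n g => // n IH g; rewrite ltnS => gn g1.
have [irr|nirr] := pselect (irreducible_poly g); first by exists g.
have g0 : g != 0 by rewrite -size_poly_gt0 (ltn_trans _ g1).
have [q [q1 qg nqg]] : exists q : {poly F}, [/\ size q != 1%N, q %| g & ~~ (q %= g)].
  apply: contrapT => h; apply: nirr; split => // q q1 qg.
  by apply/negPn/negP => nqg; apply: h; exists q.
have sqg : (size q < size g)%N.
  rewrite ltn_neqAle dvdp_leq // andbT; apply: contra nqg => /eqP e.
  by rewrite -dvdp_size_eqp // e.
have q0 : q != 0 by apply: contraTneq qg => ->; rewrite dvd0p.
have [||f irrf fq] := IH q; first by rewrite (leq_trans sqg).
  by rewrite ltn_neqAle eq_sym q1 size_poly_gt0.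
by exists f => //; exact: dvdp_trans qg.
Qed.

(** A repeated irreducible factor would not be coprime to its cofactor. *)
Lemma separable_factorization (F : fieldType) (g : {poly F}) :
  g \is monic -> separable_poly g ->
  exists s : seq {poly F}, [/\ uniq s, \prod_(f <- s) f = g &
    forall f, f \in s -> f \is monic /\ irreducible_poly f].
Proof.
have [n] := ubnP (size g); elim: n g => // n IH g; rewrite ltnS => gn mg sg.
have g0 := monic_neq0 mg.
have [g1|g1] := leqP (size g) 1.
  exists [::]; split => //; rewrite big_nil.
  by have := mg; rewrite (size1_polyC g1) monicE lead_coefC => /eqP ->.
have [f0 irr0 f0g] := irreducible_factor g1.
have f00 := irredp_neq0 irr0.
pose f := (lead_coef f0)^-1 *: f0.
have l0 : (lead_coef f0)^-1 != 0 by rewrite invr_eq0 lead_coef_eq0.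
have ff0 : f %= f0 by exact: eqp_scale.
have mf : f \is monic by rewrite monicE lead_coefZ mulVf ?lead_coef_eq0.
have irrf : irreducible_poly f.
  split=> [|q q1 qf]; first by rewrite (eqp_size ff0); exact: irr0.1.
  by rewrite (eqp_trans (irr0.2 q q1 _)) 1?eqp_sym // -(eqp_dvdr _ ff0).
have fg : f %| g by rewrite (eqp_dvdl _ ff0).
have gE := divpK fg; set h := g %/ f in gE.
have mh : h \is monic by move: mg; rewrite -gE monicMr.
have [sh sf cop] : [/\ separable_poly h, separable_poly f & coprimep h f].
  by apply/and3P; rewrite -separable_mul gE.
have h0 := monic_neq0 mh.
have hg : (size h < size g)%N.
  rewrite -gE size_mul ?monic_neq0 // -ltnS prednK; last first.
    by rewrite addn_gt0 size_poly_gt0 h0.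
  by rewrite -addn1 ltn_add2l; exact: irrf.1.
have [|//|//|s [us sE hs]] := IH h; first exact: leq_trans gn.
exists (f :: s); split.
- rewrite /= us andbT; apply/negP => fs.
  have : f %| h by rewrite -sE (big_rem f fs) dvdp_mulr.
  move=> fh; have := coprimep_sym h f; rewrite cop => /esym.
  by rewrite irreducible_coprimep // fh.
- by rewrite big_cons sE mulrC.
- by move=> f'; rewrite inE => /orP[/eqP -> //|/hs].
Qed.

Lemma normmod_prod (F : fieldType) (s : seq {poly F}) :
  (forall f, f \in s -> f != 0) ->
  size (\prod_(f <- s) f) = (\sum_(f <- s) (size f).-1).+1 /\
  forall g, normmod (\sum_(f <- s) (size f).-1) (\prod_(f <- s) f) g =
    \prod_(f <- s) normmod (size f).-1 f g.
Proof.
elim: s => [|f s IH] hs.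
  by split=> [|g]; rewrite !big_nil ?size_poly1 // /normmod det_mx00.
have f0 : f != 0 by apply: hs; rewrite mem_head.
have [|sz nm] := IH; first by move=> h hh; apply: hs; rewrite inE hh orbT.
have sf : size f = (size f).-1.+1 by rewrite prednK // size_poly_gt0.
split=> [|g]; rewrite !big_cons.
  have p0 : \prod_(f <- s) f != 0 by rewrite -size_poly_gt0 sz.
  by rewrite size_mul // sz addnS /= sf.
by rewrite (normmodMl _ sf sz) nm.
Qed.

(** The evaluation [ev] at a primitive element identifies [K] with
    [Q[X] / P]. *)
Lemma number_field_presentation (K : fieldExtType rat) :
  exists (P : {poly rat}) (ev : {rmorphism {poly rat} -> K}),
  [/\ P \is monic /\ irreducible_poly P, size P = (\dim {:K}).+1,
      forall c g, ev (c *: g) = c *: ev g,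
      forall g, ev g = 0 <-> P %| g & forall z, exists g, ev g = z].
Proof.
have sepK : separable 1%VS {:K}.
  apply/separableP => y _; apply: pcharf0_separable.
  by move=> q; rewrite pchar_lalg pchar_num.
have genK := eq_adjoin_separable_generator sepK (sub1v _).
set t := separable_generator _ _ in genK.
have [P mE] := polyOver1P (minPolyOver 1 t).
have hornerE g : horner_alg t g = (map_poly (in_alg K) g).[t] by [].
have mP : P \is monic.
  have := monic_minPoly 1 t; rewrite mE !monicE lead_coef_map /=.
  by rewrite -[_%:A]/(in_alg K _) fmorph_eq1.
have sP : size P = (\dim {:K}).+1.
  have := size_minPoly 1 t; rewrite mE size_map_poly => ->.
  by rewrite [in RHS]genK dim_Fadjoin dimv1 muln1.
have ker g : horner_alg t g = 0 <-> P %| g.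
  rewrite hornerE; split => [gt|Pg].
    rewrite -(dvdp_map (in_alg K)) -mE; apply: minPoly_dvdp; last exact/rootP.
    exact/alg_polyOver.
  apply/rootP; have : map_poly (in_alg K) P %| map_poly (in_alg K) g by rewrite dvdp_map.
  by rewrite -mE => /dvdpP[q ->]; rewrite /root hornerM minPolyxx mulr0.
exists P, (horner_alg t : {rmorphism {poly rat} -> K}); split => //.
- split; first exact: mP.
  split=> [|q q1 qP]; first by rewrite sP ltnS adim_gt0.
  have := @minPoly_irr _ _ 1%AS t (map_poly (in_alg K) q) (alg_polyOver _ _).
  rewrite mE dvdp_map => /(_ qP); rewrite -[1](rmorph1 (map_poly (in_alg K))) !eqp_map.
  by case/orP => // /eqp_size; rewrite size_poly1 => /eqP; rewrite (negPf q1).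
- by move=> c g; rewrite -mul_polyC rmorphM /= horner_algC mulr_algl.
- move=> z; have : z \in <<1%AS; t>>%VS by rewrite -genK memvf.
  case/Fadjoin_polyP => p /polyOver1P[q ->] ->; exists q; exact: hornerE.
Qed.

Section FieldNorm.
Variables (K : fieldExtType rat) (P : {poly rat}) (ev : {rmorphism {poly rat} -> K}).
Variables (d : nat) (rep : K -> {poly rat}).
Hypotheses (irrP : irreducible_poly P) (sP : size P = d.+1).
Hypothesis evker : forall g, ev g = 0 <-> P %| g.
Hypothesis repK : forall z, ev (rep z) = z.

(** The norm from [K] to the rational numbers, through a choice [rep] of
    polynomials representing the elements of [K]. *)
Definition field_norm (z : K) : rat := normmod d P (rep z).

Lemma field_norm_neq0 z : z != 0 -> field_norm z != 0.
Proof.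
move=> z0; apply: (normmod_neq0 sP); rewrite irreducible_coprimep //.
by apply: contra z0 => /evker; rewrite repK => ->.
Qed.

Section Above.
Variables (R : realType) (U : set_system nat).
Hypothesis UU : free_ultrafilter U.
Variables (F : fieldType) (absF : F -> R) (j : {rmorphism rat -> F}).
Hypothesis LF : local_field U absF j.
Hypothesis evZ : forall c g, ev (c *: g) = c *: ev g.
Hypothesis mP : P \is monic.
Let hF := lf_abs LF.

(** A pair of a map [K -> R] and an exponent; the exponent is the degree of
    the factor. *)
Definition place_of_factor (f : {poly F}) (nu : {poly F} -> R)
    (v : (K -> R) * nat) : Prop :=
  [/\ residue_abs absF f nu, forall g, v.1 (ev g) = nu (map_poly j g) &
      size f = v.2.+1].

Lemma place_of_factor_ms f nu v : place_of_factor f nu v -> mult_seminorm v.1.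
Proof.
case=> hnu vE _; have hn := ra_ms hnu; split.
- by move=> x; rewrite -(repK x) vE (ms_ge0 hn).
- by rewrite -(rmorph0 ev) vE rmorph0 (ms0 hn).
- by rewrite -(rmorph1 ev) vE rmorph1 (ms1 hn).
- by move=> x y; rewrite -{1}(repK x) -{1}(repK y) -rmorphM vE rmorphM (msM hn) -!vE !repK.
- move=> x y; rewrite -{1}(repK x) -{1}(repK y) -rmorphD vE rmorphD.
  by rewrite (le_trans (msD hn _ _)) // -!vE !repK.
Qed.

Lemma place_of_factor_rat f nu v q : place_of_factor f nu v -> v.1 q%:A = absF (j q).
Proof.
case=> hnu vE _; rewrite -(rmorph1 ev) -evZ vE -mul_polyC mulr1.
by rewrite map_polyC (ra_cst hnu).
Qed.

(** The irreducible factors of [P] over the local field give the places above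
    it, with their local degrees. *)
Lemma places_above (Q : {poly F} -> ({poly F} -> R) -> Prop) :
  (forall f, irreducible_poly f -> f %| map_poly j P ->
     exists nu, residue_abs absF f nu /\ Q f nu) ->
  exists s : seq ((K -> R) * nat),
  [/\ uniq (unzip1 s), (\sum_(v <- s) v.2 = d)%N,
      forall v, v \in s -> (v.2 <= local_degree v.1)%N /\
        exists f nu, [/\ f %| map_poly j P, Q f nu & place_of_factor f nu v],
      forall f, f \is monic -> irreducible_poly f -> f %| map_poly j P ->
        exists nu v, [/\ v \in s, Q f nu & place_of_factor f nu v] &
      forall z, absF (j (field_norm z)) <= \prod_(v <- s) v.1 z ^+ v.2].
Proof.
move=> hQ.
have sepP : separable_poly P.
  rewrite separable_poly.unlock irreducible_coprimep //; apply/negP => /dvdp_leq.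
  have P'0 : P^`() != 0.
    have d0 : (0 < d)%N by move: irrP.1; rewrite sP.
    apply/negP => /eqP P'0; have := coef_deriv P d.-1; rewrite P'0 coef0 prednK //.
    have -> : P`_d = 1 by have := mP; rewrite monicE lead_coefE sP => /eqP.
    by move/eqP; rewrite eq_sym pnatr_eq0 eqn0Ngt d0.
  by move=> /(_ P'0); rewrite leqNgt lt_size_deriv // monic_neq0.
have [||s [us sE hs]] := @separable_factorization F (map_poly j P).
- by rewrite map_monic.
- by rewrite separable_map.
have s0 f : f \in s -> f != 0 by move=> /hs[/monic_neq0].
have dvds f : f \in s -> f %| map_poly j P.
  by move=> fs; rewrite -sE (big_rem f fs) dvdp_mulr.
have [sz nm] := normmod_prod s0.
rewrite sE size_map_poly sP in sz; case: sz => dE.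
have [nu hnu] : exists nu, forall f, f \in s -> residue_abs absF f (nu f) /\ Q f (nu f).
  suff /choice[nu hnu] : forall f, exists nu, f \in s -> residue_abs absF f nu /\ Q f nu.
    by exists nu.
  move=> f; have [fs|] := boolP (f \in s); last by exists (fun=> 0).
  have [_ irrf] := hs f fs.
  by have [nu hnu] := hQ f irrf (dvds f fs); exists nu.
pose pl f : (K -> R) * nat := ((fun z => nu f (map_poly j (rep z))), (size f).-1).
have plP f : f \in s -> place_of_factor f (nu f) (pl f).
  move=> fs; have [hf _] := hnu f fs; split => //=.
    move=> g; rewrite -(ra_modp hf) -[RHS](ra_modp hf); congr (nu f _).
    apply/eqP; rewrite -subr_eq0 -modpN -modpD -rmorphB; apply/eqP/modp_eq0P.
    apply: dvdp_trans (dvds f fs) _; rewrite dvdp_map; apply/evker.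
    by rewrite rmorphB /= repK subrr.
  by rewrite prednK // size_poly_gt0 s0.
exists (map pl s); split.
- rewrite /unzip1 -map_comp map_inj_in_uniq // => f g fs gs /= eq_v.
  have [hf _ _] := plP f fs; have [hg _ _] := plP g gs.
  have E h : nu f (map_poly j h) = nu g (map_poly j h).
    have [_ vf _] := plP f fs; have [_ vg _] := plP g gs.
    by rewrite -vf -vg; exact: (congr1 (fun v => v (ev h)) eq_v).
  have [mf _] := hs f fs; have [mg _] := hs g gs.
  apply/eqP; rewrite -eqp_monic // /eqp.
  rewrite (residue_abs_eq LF hg hf) 1?(residue_abs_eq LF hf hg) //.
- by rewrite big_map -dE.
- move=> _ /mapP[f fs ->]; have [_ Qf] := hnu f fs; have pf := plP f fs.
  split; last by exists f, (nu f); split => //; exact: dvds.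
  case: (pf) => hf vE sf.
  apply: (@local_degree_ge _ _ UU _ _ _ LF _ ev evZ _ _ f (nu f)) => //.
  by move=> z; exists (rep z).
- move=> f mf irrf fP.
  have [g gs fg] : exists2 g, g \in s & f %| g.
    move: fP; rewrite -sE; elim: (s) => [|g r IH].
      by rewrite big_nil dvdp1 => /eqP sf; move: irrf.1; rewrite sf.
    rewrite big_cons; have [fg|nfg] := boolP (f %| g).
      by exists g => //; rewrite mem_head.
    rewrite Gauss_dvdpr ?irreducible_coprimep // => /IH[h hr fh].
    by exists h => //; rewrite inE hr orbT.
  have [mg irrg] := hs g gs.
  have fE : f = g.
    apply/eqP; rewrite -eqp_monic //; apply: irrg.2 => //.
    by rewrite gtn_eqF //; exact: irrf.1.
  exists (nu f), (pl f); rewrite fE; split; last exact: plP.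
    by rewrite map_f.
  by have [] := hnu g gs.
- move=> z; rewrite /field_norm (map_normmod j) -sE dE nm (ms_prod hF) big_map.
  rewrite [leLHS]big_seq [leRHS]big_seq; apply: ler_prod => f fs.
  have [hf _ sf] := plP f fs; rewrite (ms_ge0 hF) /=.
  exact: (normmod_le_ra UU LF sf hf).
Qed.

End Above.
End FieldNorm.

Lemma residue_abs_root (R : realType) (f : {poly R}) (r : R[i]) :
  irreducible_poly f -> root (map_poly (real_complex R) f) r ->
  residue_abs (fun x : R => `|x|) f
    (fun g => Normc.normc (map_poly (real_complex R) g).[r]).
Proof.
move=> irrf fr; split.
- split.
  + by move=> x; case: (_.[r]) => a b; rewrite /= sqrtr_ge0.
  + by rewrite rmorph0 horner0 Normc.normc0.
  + by rewrite rmorph1 hornerC Normc.normc1.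
  + by move=> x y; rewrite rmorphM hornerM Normc.normcM.
  + by move=> x y; rewrite rmorphD hornerD le_normcD.
- by move=> c; rewrite map_polyC hornerC /= expr0n addr0 sqrtr_sqr.
- move=> g; split => [/Normc.eq0_normc gr|/dvdpP[q ->]]; last first.
    by rewrite rmorphM hornerM (rootP fr) mulr0 Normc.normc0.
  apply/negPn; rewrite -irreducible_coprimep //; apply/negP.
  rewrite -(coprimep_map (real_complex R)) => /coprimep_root/(_ fr).
  by rewrite gr eqxx.
Qed.

Lemma complex_root_exists (R : realType) (f : {poly R}) : irreducible_poly f ->
  exists r : R[i], root (map_poly (real_complex R) f) r.
Proof.
move=> irrf; apply/closed_rootP; rewrite size_map_poly.
by rewrite gtn_eqF //; exact: irrf.1.
Qed.

Section NumberField.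
Variables (R : realType) (K : fieldExtType rat).
Variables (P : {poly rat}) (ev : {rmorphism {poly rat} -> K}).
Variables (d : nat) (rep : K -> {poly rat}).
Hypotheses (mP : P \is monic) (irrP : irreducible_poly P) (sP : size P = d.+1).
Hypothesis evZ : forall c g, ev (c *: g) = c *: ev g.
Hypothesis evker : forall g, ev g = 0 <-> P %| g.
Hypothesis repK : forall z, ev (rep z) = z.

Lemma rmorph_ev (E : fieldType) (h : {rmorphism K -> E}) (j : {rmorphism rat -> E}) g :
  h (ev g) = (map_poly j g).[h (ev 'X)].
Proof.
have hQ c : h (c%:A) = j c.
  rewrite -[h _]/((h \o in_alg K) c).
  rewrite (fmorph_eq_rat (h \o in_alg K)).
  by rewrite (fmorph_eq_rat j).
elim/poly_ind: g => [|g c IH]; first by rewrite !rmorph0 horner0.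
rewrite !rmorphD !rmorphM /= map_polyX map_polyC hornerMXaddC IH; congr (_ + _).
by rewrite -[c%:P]mulr1 mul_polyC evZ rmorph1 hQ.
Qed.

(** A real irreducible factor with complex root [r] gives the place of the
    embedding that sends the generator to [r].  The root [iota (ev 'X)] is real,
    so the place of [iota] has exponent 1. *)
Lemma archimedean_places_above (iota : {rmorphism K -> R}) :
  exists s : seq ((K -> R) * nat),
  [/\ uniq (unzip1 s), (\sum_(v <- s) v.2 = d)%N,
      forall v, v \in s -> (v.2 <= local_degree v.1)%N /\ archimedean_place v.1,
      ((fun x => `|iota x|), 1%N) \in s &
      forall z, `|ratr (field_norm P d rep z)| <= \prod_(v <- s) v.1 z ^+ v.2].
Proof.
have [U UU] := free_ultrafilter_exists.
pose Q (f : {poly R}) (nu : {poly R} -> R) := exists r : R[i],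
  root (map_poly (real_complex R) f) r /\
  nu = fun g => Normc.normc (map_poly (real_complex R) g).[r].
have [|s [us sd hs hf hN]] :=
  places_above irrP sP evker repK UU (real_local_field R UU) evZ mP (Q := Q).
  move=> f irrf _; have [r fr] := complex_root_exists irrf.
  by eexists; split; [exact: residue_abs_root irrf fr|exists r; split].
exists s; split => //.
- move=> v /hs[vd [f [nu [fP [r [fr nuE]] [_ vE _]]]]]; split => //.
  pose sg z : R[i] := (map_poly (real_complex R) (map_poly ratr (rep z))).[r].
  have sgE g : sg (ev g) = (map_poly (real_complex R) (map_poly ratr g)).[r].
    apply/eqP; rewrite -subr_eq0 -hornerN -hornerD -!rmorphB /=.
    have /evker : ev (rep (ev g) - g) = 0 by rewrite rmorphB /= repK subrr.
    rewrite -(dvdp_map (@ratr R)) => /(dvdp_trans fP)/dvdpP[q ->].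
    by rewrite rmorphM hornerM (rootP fr) mulr0.
  have sgB : zmod_morphism sg.
    by move=> x y; rewrite -{1}(repK x) -{1}(repK y) -rmorphB sgE !rmorphB hornerD hornerN.
  have sgM : monoid_morphism sg.
    split; first by rewrite -(rmorph1 ev) sgE !rmorph1 hornerC.
    by move=> x y; rewrite -{1}(repK x) -{1}(repK y) -rmorphM sgE !rmorphM hornerM.
  pose sg' : {rmorphism K -> R[i]} := HB.pack sg
    (GRing.isZmodMorphism.Build _ _ sg sgB) (GRing.isMonoidMorphism.Build _ _ sg sgM).
  exists sg'; apply/funext => x.
  by rewrite -{1}(repK x) vE nuE.
- pose a := iota (ev 'X).
  have [|nu [v [vs [r [fr nuE]] [_ vE sv]]]] := hf _ (monicXsubC a) (irredp_XsubC a).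
    rewrite dvdp_XsubCl; apply/rootP.
    rewrite -[LHS](rmorph_ev iota).
    by have -> : ev P = 0; [exact/evker|rewrite rmorph0].
  have rE : r = a%:C%C.
    by move: fr; rewrite map_polyXsubC root_XsubC => /eqP.
  have v2 : v.2 = 1%N by move: sv; rewrite size_XsubC => -[].
  suff v1 : v.1 = (fun x => `|iota x|).
    by rewrite -v1 -v2 -surjective_pairing.
  apply/funext => x; rewrite -(repK x) vE nuE rE.
  rewrite [in RHS](rmorph_ev iota (@ratr R)).
  by rewrite horner_map /= expr0n addr0 sqrtr_sqr.
Qed.

Lemma padic_places_above (p : nat) : prime p ->
  exists s : seq ((K -> R) * nat),
  [/\ uniq (unzip1 s),
      forall v, v \in s -> [/\ (v.2 <= local_degree v.1)%N,
        nonarchimedean_place v.1 & forall q : rat, v.1 q%:A = padic_abs R p q] &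
      forall z, padic_abs R p (field_norm P d rep z) <= \prod_(v <- s) v.1 z ^+ v.2].
Proof.
move=> pp; have [U UU] := free_ultrafilter_exists.
have [F [absF [j [LF jw ultraF]]]] := padic_field_exists R pp UU.
pose Q (f : {poly F}) (nu : {poly F} -> R) :=
  forall g h, nu (g + h) <= Num.max (nu g) (nu h).
have [|s [us sd hs hf hN]] := places_above irrP sP evker repK UU LF evZ mP (Q := Q).
  move=> f irrf _; have s1 := irrf.1.
  have sf : size f = (size f).-2.+2 by case: (size f) s1 => [|[|n]].
  exact: (residue_abs_ultra_exists UU LF ultraF sf irrf).
exists s; split => //; last by move=> z; rewrite -jw hN.
move=> v /hs[vd [f [nu [fP ultra pf]]]].
have vq q : v.1 q%:A = padic_abs R p q.
  by rewrite (place_of_factor_rat evZ _ pf) jw.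
have hv := place_of_factor_ms repK pf.
split => //; split; last by exists p.
- split; [exact: (ms_ge0 hv)| |exact: (msM hv)|exact: (msD hv)].
  by move=> x; rewrite (ms_eq0 _ hv).
- case: pf => _ vE _ x y.
  by rewrite -(repK x) -(repK y) -rmorphD !vE rmorphD ultra.
Qed.

End NumberField.

(** * Finiteness of the product defining the height *)

Section Finiteness.
Variables (R : realType) (K : fieldExtType rat).
Implicit Types v w : K -> R.

Definition place_over (p : nat) v : Prop :=
  nonarchimedean_place v /\ forall q : rat, v q%:A = padic_abs R p q.

Lemma absolute_value_ms v : absolute_value v -> mult_seminorm v.
Proof.
case=> v_ge0 v_eq0 vM vD; have v0 : v 0 = 0 by apply/eqP; rewrite v_eq0.
have v1 : v 1 = 1.
  have v1n : v 1 != 0 by rewrite v_eq0 oner_eq0.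
  by apply: (mulfI v1n); rewrite -vM !mulr1.
by split.
Qed.

Lemma place_over_ms p v : place_over p v -> mult_seminorm v.
Proof. by case=> [[/absolute_value_ms]]. Qed.

Lemma place_over_ultra p v : place_over p v ->
  forall x y, v (x + y) <= Num.max (v x) (v y).
Proof. by case=> [[]]. Qed.

Section AboveOnePrime.
Variable p : nat.
Hypothesis pp : prime p.
Let p_gt1 : 1 < p%:R :> R. Proof. by rewrite ltr1n prime_gt1. Qed.
Let p_gt0 : 0 < p%:R :> R. Proof. exact: lt_trans p_gt1. Qed.

Lemma place_over_p v : place_over p v -> v (p%:R)%:A = p%:R^-1.
Proof. by case=> _ ->; rewrite padic_abs_p. Qed.

(** Rescaling a large power of [z] by a power of [p] amplifies the gap between
    [v z] and [w z] until it straddles 1. *)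
Lemma places_straddle v w z : place_over p v -> place_over p w -> v z < w z ->
  exists a, v a < 1 <= w a.
Proof.
move=> hv hw vw; have mv := place_over_ms hv; have mw := place_over_ms hw.
have z0 : z != 0.
  by apply: contraTneq vw => ->; rewrite (ms0 mv) (ms0 mw) ltxx.
have vz : 0 < v z by rewrite lt_def (ms_ge0 mv) (ms_eq0 _ mv) z0.
have [m hm] : exists m, p%:R * v z ^+ m < w z ^+ m.
  apply: contrapT => h.
  have : w z <= v z.
    apply: (@le_of_expr_le _ _ _ p%:R); rewrite ?(ms_ge0 mw) ?(ltW vz) // => m.
    by rewrite leNgt; apply/negP => hm; apply: h; exists m.
  by rewrite leNgt vw.
have ym : 0 < v z ^+ m by rewrite exprn_gt0.
have [N hN] := lt_prime_power pp (v z ^- m).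
pose y := v z ^+ m * p%:R ^+ N.
have y1 : 1 < y by move: hN; rewrite -[_ ^- m]mul1r ltr_pdivrMr // mulrC.
have exk : exists k, y < p%:R ^+ k by exact: lt_prime_power.
pose k := ex_minn exk.
have [yk kmin] : y < p%:R ^+ k /\ forall l, y < p%:R ^+ l -> (k <= l)%N.
  by rewrite /k; case: ex_minnP.
have k0 : (0 < k)%N.
  by rewrite lt0n; apply: contraTneq yk => ->; rewrite expr0 -leNgt ltW.
have py : p%:R ^+ k <= p%:R * y.
  rewrite -(prednK k0) exprS ler_pM2l // leNgt; apply/negP => /kmin.
  by rewrite -ltnS prednK // ltnn.
exists (z ^+ m * (p%:R%:A ^+ k / p%:R%:A ^+ N)).
have vE u : place_over p u -> u (z ^+ m * (p%:R%:A ^+ k / p%:R%:A ^+ N)) =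
    u z ^+ m * p%:R ^+ N / p%:R ^+ k.
  move=> hu; have mu := place_over_ms hu.
  rewrite !(msM mu) (msV _ mu) !(msX mu) (place_over_p hu).
  by rewrite !exprVn invrK -mulrA [_^-1 * _]mulrC.
rewrite !vE // ltr_pdivrMr ?exprn_gt0 // mul1r yk /=.
rewrite ler_pdivlMr ?exprn_gt0 // mul1r (le_trans py) // /y mulrA.
by rewrite ler_pM2r ?exprn_gt0 // ltW.
Qed.

(** As [z] and [z^-1] order the two places in opposite ways, both kinds of
    straddling elements exist, and their quotient separates the places. *)
Lemma places_separate2 v w : place_over p v -> place_over p w -> v <> w ->
  exists a, 1 < v a /\ w a < 1.
Proof.
move=> hv hw vw; have mv := place_over_ms hv; have mw := place_over_ms hw.
have [z hz] : exists z, v z < w z.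
  have [z vwz] : exists z, v z != w z.
    by apply: contrapT => h; apply: vw; apply/funext => z;
      apply/eqP/negPn/negP => hz; apply: h; exists z.
  have z0 : z != 0 by apply: contraNneq vwz => ->; rewrite (ms0 mv) (ms0 mw).
  move: vwz; rewrite neq_lt => /orP[|wv]; first by exists z.
  exists z^-1; rewrite (msV _ mv) (msV _ mw) ltf_pV2 // posrE lt_def
    ?(ms_ge0 mv) ?(ms_ge0 mw) andbT.
    by rewrite (ms_eq0 _ mv).
  by rewrite (ms_eq0 _ mw).
have z0 : z != 0.
  by apply: contraTneq hz => ->; rewrite (ms0 mv) (ms0 mw) ltxx.
have vz : 0 < v z by rewrite lt_def (ms_ge0 mv) (ms_eq0 _ mv) z0.
have hz' : w z^-1 < v z^-1.
  by rewrite (msV _ mv) (msV _ mw) ltf_pV2 // posrE (lt_trans vz).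
have [a /andP[va wa]] := places_straddle hv hw hz.
have [b /andP[wb vb]] := places_straddle hw hv hz'.
have a0 : a != 0.
  by apply: contraTneq wa => ->; rewrite (ms0 mw) -ltNge.
have va0 : 0 < v a by rewrite lt_def (ms_ge0 mv) (ms_eq0 _ mv) a0.
exists (b / a); rewrite !(msM mv, msM mw) (msV _ mv) (msV _ mw); split.
  by rewrite ltr_pdivlMr // mul1r (lt_le_trans va).
rewrite ltr_pdivrMr ?mul1r; last exact: lt_le_trans wa.
exact: lt_le_trans wa.
Qed.

Lemma expr_mul_small (C x : R) : 0 <= x < 1 ->
  \forall m \near \oo, x ^+ m * C < 1.
Proof.
move=> /andP[x0 x1].
have h : (fun m => x ^+ m * C) @ \oo --> (0 : R).
  rewrite -[X in _ --> X](mul0r C); apply: cvgM; last exact: cvg_cst.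
  by apply: cvg_expr; rewrite ger0_norm.
exact: (cvgr_lt _ h _ ltr01).
Qed.

Lemma expr_mul_small_seq (ws : seq (K -> R)) a b :
  (forall w, w \in ws -> mult_seminorm w /\ w a < 1) ->
  \forall m \near \oo, forall w, w \in ws -> w a ^+ m * w b < 1.
Proof.
elim: ws => [|w ws IH] hws; first by apply: nearW => m w.
have [|mw wa] := hws w; first by rewrite mem_head.
have {}IH : \forall m \near \oo, forall w, w \in ws -> w a ^+ m * w b < 1.
  by apply: IH => u hu; apply: hws; rewrite inE hu orbT.
have hw : \forall m \near \oo, w a ^+ m * w b < 1.
  by apply: expr_mul_small; rewrite (ms_ge0 mw).
near=> m => u; rewrite inE => /orP[/eqP ->|]; first by near: m.
by move: u; near: m.
Unshelve. all: by end_near. Qed.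

(** Weak approximation: an element [a] that is good for the list [ws] is made
    good at one more place [w0] by means of [b] that separates [v] from [w0].
    The factor [a ^+ m], or [a ^+ m / (1 + a ^+ m)] when [w0 a > 1], makes the
    values at [ws] small without spoiling those at [v] and [w0]. *)
Lemma places_separate v (ws : seq (K -> R)) : place_over p v ->
  (forall w, w \in ws -> place_over p w /\ v <> w) ->
  exists a, 1 < v a /\ forall w, w \in ws -> w a < 1.
Proof.
move=> hv; have mv := place_over_ms hv.
elim: ws => [|w0 ws IH] hws.
  exists (p%:R%:A)^-1; split=> //; rewrite (msV _ mv) (place_over_p hv) invrK.
  exact: p_gt1.
have [|a [va wa]] := IH.
  by move=> w hw; apply: hws; rewrite inE hw orbT.
have [hw0 vw0] := hws w0 (mem_head _ _); have mw0 := place_over_ms hw0.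
have [b [vb wb]] := places_separate2 hv hw0 vw0.
have hs w : w \in ws -> mult_seminorm w /\ w a < 1.
  move=> hw; split; last exact: wa.
  by have [|/place_over_ms //] := hws w; rewrite inE hw orbT.
have [m hm] := filter_ex (expr_mul_small_seq b hs).
have vam : 1 <= v a ^+ m by rewrite exprn_ege1 // ltW.
have [w0a|w0a] := ltP (w0 a) 1.
  by exists a; split=> // w; rewrite inE => /orP[/eqP -> //|/wa].
have [w0a1|w0a1] := eqVneq (w0 a) 1.
  exists (a ^+ m * b); split.
    rewrite (msM mv) (msX mv) (lt_le_trans vb) // ler_peMl //.
    exact: ms_ge0 mv _.
  move=> w; rewrite inE => /orP[/eqP ->|hw].
    by rewrite (msM mw0) (msX mw0) w0a1 expr1n mul1r.
  by have [mw _] := hs w hw; rewrite (msM mw) (msX mw) hm.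
(* In [1 + a ^+ m] the second term dominates where [a] is large, and the
   first one where [a] is small. *)
have big u : place_over p u -> 1 < u a -> (0 < m)%N -> u (1 + a ^+ m) = u a ^+ m.
  move=> hu ua m0; have mu := place_over_ms hu.
  have uam : 1 < u (a ^+ m) by rewrite (msX mu) exprn_egt1 // -lt0n.
  apply/eqP; rewrite eq_le -{1 2}(msX mu); apply/andP; split.
    by rewrite (le_trans (place_over_ultra hu _ _)) // (ms1 mu) ge_max lexx ltW.
  rewrite leNgt; apply/negP => lt1.
  have := place_over_ultra hu (1 + a ^+ m) (- 1).
  rewrite addrC addKr (msN mu) (ms1 mu) leNgt => /negP; apply.
  by rewrite gt_max lt1.
have small u : place_over p u -> u a < 1 -> (0 < m)%N -> u (1 + a ^+ m) = 1.
  move=> hu ua m0; have mu := place_over_ms hu.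
  have uam : u (a ^+ m) < 1 by rewrite (msX mu) exprn_ilt1 ?(ms_ge0 mu) // -lt0n.
  apply/eqP; rewrite eq_le; apply/andP; split.
    by rewrite (le_trans (place_over_ultra hu _ _)) // (ms1 mu) ge_max lexx ltW.
  rewrite leNgt; apply/negP => lt1.
  have := place_over_ultra hu (1 + a ^+ m) (- a ^+ m).
  rewrite addrK (msN mu) (ms1 mu) leNgt => /negP; apply.
  by rewrite gt_max lt1.
have [m0|m0] := posnP m; last first.
  exists (a ^+ m / (1 + a ^+ m) * b).
  have w0a' : 1 < w0 a by rewrite lt_def w0a1.
  split.
    rewrite !(msM mv) (msV _ mv) big // (msX mv) divff ?mul1r //.
    by rewrite gt_eqF // (lt_le_trans ltr01).
  move=> w; rewrite inE => /orP[/eqP ->|hw].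
    rewrite !(msM mw0) (msV _ mw0) big // (msX mw0) divff ?mul1r //.
    by rewrite gt_eqF // exprn_gt0 // (lt_trans ltr01).
  have [mw w1] := hs w hw.
  have hw' : place_over p w by have [|//] := hws w; rewrite inE hw orbT.
  by rewrite !(msM mw) (msV _ mw) small // invr1 mulr1 (msX mw) hm.
exists b; split=> // w; rewrite inE => /orP[/eqP -> //|hw].
by have := hm w hw; rewrite m0 expr0 mul1r.
Qed.

(** Elements [a i] large at the place [v i] only are linearly independent: in a
    relation, the term with the largest coefficient [c l] dominates at [v l]. *)
Lemma places_over_bound (vs : seq (K -> R)) : uniq vs ->
  (forall v, v \in vs -> place_over p v) -> (size vs <= \dim {:K})%N.
Proof.
move=> uvs hvs; pose n := size vs.
pose v (i : 'I_n) := nth (fun=> 0) vs i.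
have vvs i : v i \in vs by rewrite mem_nth.
have hv i : place_over p (v i) by exact: hvs.
have sep i : exists a, 1 < v i a /\ forall k, k != i -> v k a < 1.
  have [|a [va wa]] := @places_separate (v i) (rem (v i) vs) (hv i).
    move=> w; rewrite mem_rem_uniq // inE => /andP[/= wv wvs].
    by split; [exact: hvs|apply/eqP; rewrite eq_sym].
  exists a; split=> // k ki; apply: wa; rewrite mem_rem_uniq // inE /= vvs andbT.
  by rewrite /v nth_uniq.
have [a ha] := choice sep.
pose X := [tuple a i | i < n].
suff /eqP frX : free X.
  by have := dimvS (subvf <<X>>%VS); rewrite frX size_tuple.
apply/freeP => c c0 i; apply/eqP/negPn/negP => ci.
pose l := [arg max_(l > i) padic_abs R p (c l)]%O.
have maxl k : padic_abs R p (c k) <= padic_abs R p (c l).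
  by rewrite /l; case: arg_maxP => // s _ hs; exact: hs.
have hw := padic_abs_ms R pp.
have cl : 0 < padic_abs R p (c l).
  by apply: lt_le_trans (maxl i); rewrite lt_def (ms_ge0 hw) (ms_eq0 _ hw) ci.
have mv := place_over_ms (hv l); have uv := place_over_ultra (hv l).
have vl q x : v l (q *: x) = padic_abs R p q * v l x.
  by rewrite -mulr_algl (msM mv) (proj2 (hv l)).
have XE (k : 'I_n) : X`_k = a k by rewrite -tnth_nth tnth_mktuple.
have := c0; under eq_bigr do rewrite XE.
rewrite (bigD1 l) //= => /eqP; rewrite addr_eq0 => /eqP/(congr1 (v l)).
rewrite (msN mv) vl => E.
have [la lk] := ha l.
have : padic_abs R p (c l) * v l (a l) <= padic_abs R p (c l).
  rewrite E; apply: (ultra_sum mv _ uv) => [|k kl]; first exact: ltW.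
  rewrite vl -[leRHS]mulr1.
  have [_ ak] := ha k; rewrite ler_pM ?(ms_ge0 hw) ?(ms_ge0 mv) //.
  by rewrite ltW // ak // eq_sym.
by rewrite ger_pMr // leNgt la.
Qed.

Lemma finite_places_over : finite_set [set v | place_over p v].
Proof.
apply: contrapT => inf.
have [B sB cB] := infinite_set_fset (\dim {:K}).+1 inf.
have := @places_over_bound B (fset_uniq B) (fun v vB => sB v vB).
by rewrite leqNgt; case/negP.
Qed.

End AboveOnePrime.

(** An embedding is determined by the root of [P] to which it sends the
    generator. *)
Lemma finite_archimedean_places : finite_set [set v : K -> R | archimedean_place v].
Proof.
have [P [ev [[mP _] sP evZ evker evsurj]]] := number_field_presentation K.
have [rep repK] := choice evsurj.
pose q := map_poly (@ratr R[i]) P.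
have [rs qE] := closed_field_poly_normal q.
pose f (r : R[i]) (x : K) : R := Normc.normc (map_poly (@ratr R[i]) (rep x)).[r].
apply: (@sub_finite_set _ _ (f @` [set` rs])); last first.
  by apply: finite_image; exact: finite_seq.
move=> v [s ->]; exists (s (ev 'X)) => /=.
  have q0 : lead_coef q != 0 by rewrite lead_coef_eq0 map_poly_eq0 monic_neq0.
  rewrite -root_prod_XsubC -(rootZ _ _ q0) -qE; apply/rootP.
  rewrite -(rmorph_ev evZ s); have -> : ev P = 0; first exact/evker.
  by rewrite rmorph0.
by apply/funext => x; rewrite /f -(rmorph_ev evZ s (@ratr R[i])) repK.
Qed.

(** A place where [x] is large lies over a prime dividing a denominator of the
    minimal polynomial of [x]. *)
Lemma large_place_prime (x : K) : exists L : seq nat, forall p v,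
  prime p -> place_over p v -> 1 < v x -> p \in L.
Proof.
have [q qE] := polyOver1P (minPolyOver 1 x).
have mq : q \is monic.
  have := monic_minPoly 1 x; rewrite qE !monicE lead_coef_map /=.
  by rewrite -[_%:A]/(in_alg K _) fmorph_eq1.
exists (flatten [seq primes `|denq c| | c <- q]) => p v pp hv vx.
have mv := place_over_ms hv.
apply/negPn/negP => pL.
have qi i : padic_abs R p q`_i <= 1.
  have [iq|iq] := ltnP i (size q); last first.
    by rewrite nth_default // padic_abs0.
  have pd : ~~ (p %| `|denq q`_i|)%N.
    apply: contra pL => pd; apply/flattenP; exists (primes `|denq q`_i|).
      by apply: map_f; rewrite mem_nth.
    by rewrite mem_primes pp absz_gt0 denq_neq0.
  have : padic_abs R p q`_i * padic_abs R p (denq q`_i)%:~R <= 1.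
    rewrite -padic_absM // -{1}(divq_num_den q`_i) divfK ?padic_abs_int_le1 //.
    by rewrite intr_eq0 denq_neq0.
  by rewrite (padic_abs_unit R pd) mulr1.
have q0 : q != 0 by rewrite monic_neq0.
have sq : size q = (size q).-1.+1 by rewrite prednK // size_poly_gt0.
set n := (size q).-1 in sq.
have qx : \sum_(i < n) q`_i *: x ^+ i = - x ^+ n.
  have : (map_poly (in_alg K) q).[x] = 0 by rewrite -qE minPolyxx.
  rewrite horner_coef size_map_poly sq big_ord_recr /= !coef_map /=.
  have -> : q`_n = 1 by have := mq; rewrite monicE lead_coefE => /eqP.
  rewrite scale1r mul1r => /eqP; rewrite addr_eq0 => /eqP <-.
  by apply: eq_bigr => i _; rewrite coef_map /= mulr_algl.
have n0 : (0 < n)%N.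
  rewrite lt0n; apply/eqP => n0; move: qx; rewrite n0 big_ord0 expr0 => /eqP.
  by rewrite eq_sym oppr_eq0 oner_eq0.
have : v x ^+ n <= v x ^+ n.-1.
  rewrite -(msX mv) -(msN mv) -qx.
  apply: (ultra_sum mv _ (place_over_ultra hv)) => [|i _].
    by rewrite exprn_ge0 ?(ms_ge0 mv).
  rewrite -mulr_algl (msM mv) (proj2 hv) (msX mv) -[leRHS]mul1r.
  rewrite ler_pM ?exprn_ge0 ?(ms_ge0 mv) ?padic_abs_ge0 ?qi //.
  by rewrite ler_weXn2l ?(ltW vx) // -ltnS prednK // ltn_ord.
rewrite -{1}(prednK n0) exprS ger_pMl ?leNgt ?vx //.
by rewrite exprn_gt0 // (lt_trans ltr01).
Qed.

Lemma finite_height_support (x : K) : finite_set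
  [set v | @places R K v /\
     Num.max 1 (v x) `^ ((local_degree v)%:R / (\dim {:K})%:R) != 1].
Proof.
have [L hL] := large_place_prime x.
apply: (@sub_finite_set _ _ ([set v | archimedean_place v] `|`
   \bigcup_(p in [set` [seq p <- L | prime p]]) [set v | place_over p v])); last first.
  rewrite finite_setU; split; first exact: finite_archimedean_places.
  apply: bigcup_finite; first exact: finite_seq.
  by move=> p /=; rewrite mem_filter => /andP[pp _]; exact: finite_places_over.
move=> v [[av|nv] /eqP v1]; first by left.
have [_ _ [p pp vp]] := nv; right; exists p; last by split.
rewrite /= mem_filter pp /=; apply: (hL p v) => //.
rewrite ltNge; apply/negP => vx; apply: v1.
by rewrite max_l // powR1.
Qed.

(** * Lower bounds for the height *)

Lemma prod_ge1_sub (T : eqType) (s t : seq T) (G : T -> R) :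
  uniq s -> uniq t -> (forall x, 1 <= G x) ->
  (forall x, x \in s -> x \notin t -> G x = 1) ->
  \prod_(x <- s) G x <= \prod_(x <- t) G x.
Proof.
move=> us ut G1 Gst.
rewrite (bigID (fun x => x \in t)) /= [X in _ * X]big1_seq ?mulr1; last first.
  by move=> x /andP[xt xs]; exact: Gst.
rewrite [leRHS](bigID (fun x => x \in s)) /= -!(big_filter _ (fun x => x \in _)).
have -> : \prod_(x <- [seq x <- s | x \in t]) G x = \prod_(x <- [seq x <- t | x \in s]) G x.
  apply: perm_big; apply: uniq_perm; rewrite ?filter_uniq // => x.
  by rewrite !mem_filter andbC.
rewrite ler_peMr //.
  by apply: prodr_ge0 => x _; exact: le_trans (G1 x).
by apply: (big_ind (fun y => 1 <= y)) => // y z; exact: mulr_ege1.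
Qed.

(** The factors of the height are at least 1, so places may be omitted and local
    degrees replaced by smaller exponents. *)
Lemma weil_height_ge (x : K) (s : seq ((K -> R) * nat)) : uniq (unzip1 s) ->
  (forall u, u \in s -> (u.2 <= local_degree u.1)%N /\ @places R K u.1) ->
  \prod_(u <- s) Num.max 1 (u.1 x) ^+ u.2 <= weil_height R x ^+ \dim {:K}.
Proof.
move=> us hs; set d := \dim {:K}.
have d0 : d%:R != 0 :> R by rewrite pnatr_eq0 -lt0n adim_gt0.
pose G (v : K -> R) := Num.max 1 (v x) ^+ local_degree v.
have M1 (v : K -> R) : 1 <= Num.max 1 (v x) by rewrite le_max lexx.
have G1 v : 1 <= G v by exact: exprn_ege1.
have GE v : (Num.max 1 (v x) `^ ((local_degree v)%:R / d%:R)) ^+ d = G v.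
  rewrite -powR_mulrn ?powR_ge0 // -powRrM divfK // powR_mulrn //.
  exact: le_trans (M1 v).
rewrite /weil_height -/d.
case: finite_supportP => [inf|X XP Xout _].
  case: inf; apply: sub_finite_set (finite_height_support x) => v /= [pv h].
  by split=> //; exact/eqP.
rewrite -prodrXl; under [leRHS]eq_bigr do rewrite GE.
apply: (@le_trans _ _ (\prod_(v <- unzip1 s) G v)).
  rewrite big_map big_seq [leRHS]big_seq; apply: ler_prod => v vs.
  have [vd _] := hs v vs; rewrite exprn_ge0 ?(le_trans ler01 (M1 _)) //=.
  exact: ler_weXn2l.
apply: prod_ge1_sub => //; first exact: fset_uniq.
move=> v /mapP[u us' ->] uX.
have [_ pu] := hs u us'.
by rewrite -GE (Xout _ pu) ?expr1n.
Qed.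

End Finiteness.

(** * Liouville's inequality *)

Lemma prod_primes_logn (m M : nat) : (0 < M)%N -> (m %| M)%N ->
  (\prod_(p <- primes M) p ^ logn p m = m)%N.
Proof.
move=> M0 mM; have m0 : (0 < m)%N by exact: dvdn_gt0 mM.
rewrite (bigID (fun p => p \in primes m)) /= [X in (_ * X)%N]big1_seq ?muln1; last first.
  move=> p /andP[pm]; rewrite mem_primes => /and3P[pp _ _].
  by move: pm; rewrite -logn_gt0 -leqNgt leqn0 => /eqP ->.
rewrite [RHS](prod_prime_decomp m0) prime_decompE big_map -big_filter.
apply: perm_big; apply: uniq_perm; rewrite ?filter_uniq ?primes_uniq // => p.
rewrite mem_filter andb_idr // !mem_primes => /and3P[-> _ pm].
by rewrite M0 (dvdn_trans pm).
Qed.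

Lemma rat_product_formula (R : realType) (q : rat) : q != 0 ->
  `|ratr q : R| *
    \prod_(p <- primes (`|numq q| * `|denq q|)) padic_abs R p q = 1.
Proof.
move=> q0; set n := `|numq q|%N; set m := `|denq q|%N.
have n0 : (0 < n)%N by rewrite absz_gt0 numq_eq0.
have m0 : (0 < m)%N by rewrite absz_gt0 denq_neq0.
have mn : (0 < n * m)%N by rewrite muln_gt0 n0.
have nR : n%:R != 0 :> R by rewrite pnatr_eq0 -lt0n.
have mR : m%:R != 0 :> R by rewrite pnatr_eq0 -lt0n.
have -> : `|ratr q : R| = n%:R / m%:R.
  by rewrite /ratr normrM normfV !natr_absz !intr_norm.
have P (l : nat) : (l %| n * m)%N ->
    \prod_(p <- primes (n * m)) p%:R ^+ logn p l = l%:R :> R.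
  move=> lnm; rewrite -{2}(prod_primes_logn mn lnm) natr_prod.
  by apply: eq_bigr => p _; rewrite natrX.
have -> : \prod_(p <- primes (n * m)) padic_abs R p q =
   \prod_(p <- primes (n * m)) (p%:R ^+ logn p m / p%:R ^+ logn p n).
  apply: eq_big_seq => p; rewrite mem_primes => /andP[pp _].
  rewrite /padic_abs (negPf q0) expfzDr ?exprnN //.
  by rewrite pnatr_eq0 -lt0n prime_gt0.
rewrite prodf_div (P _ (dvdn_mull n (dvdnn m))) (P _ (dvdn_mulr m (dvdnn n))).
by field; rewrite nR mR.
Qed.

Lemma le_max1M (R : realType) (a b : R) : a <= Num.max 1 a * Num.max 1 b.
Proof.
have le1 (c : R) : 1 <= Num.max 1 c by rewrite le_max lexx.
apply: (@le_trans _ _ (Num.max 1 a)); first by rewrite le_max lexx orbT.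
by rewrite ler_peMr // (le_trans ler01).
Qed.

Section Liouville.
Variables (R : realType) (K : fieldExtType rat).

Lemma archimedean_place_ms (v : K -> R) : archimedean_place v -> mult_seminorm v.
Proof.
case=> s ->; split.
- by move=> x; case: (s x) => a b; rewrite /= sqrtr_ge0.
- by rewrite rmorph0 Normc.normc0.
- by rewrite rmorph1 Normc.normc1.
- by move=> x y; rewrite rmorphM Normc.normcM.
- by move=> x y; rewrite rmorphD le_normcD.
Qed.

Lemma archimedean_place_not_over p (v : K -> R) : prime p ->
  archimedean_place v -> ~ place_over p v.
Proof.
move=> pp [s vE] hv; have := proj2 hv 2%:~R; rewrite vE.
have -> : s (2%:~R%:A) = 2%:R by rewrite -[_%:A]/(in_alg K _) !rmorph_int.
move=> h; have := padic_abs_int_le1 R pp 2; rewrite -h.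
by rewrite /= addr0 expr0n addr0 sqrtr_sqr ger0_norm // leNgt ltrDl ltr01.
Qed.

Lemma place_over_inj p1 p2 (v : K -> R) : prime p1 -> prime p2 ->
  place_over p1 v -> place_over p2 v -> p1 = p2.
Proof.
move=> pp1 pp2 h1 h2; apply/eqP/negPn/negP => p12.
have := place_over_p pp1 h1; rewrite (proj2 h2).
rewrite -[p1%:R]/(p1%:Z%:~R) padic_abs_unit; last first.
  by rewrite absz_nat dvdn_prime2 // eq_sym.
move/eqP; rewrite eq_sym invr_eq1 pnatr_eq1 => /eqP p1E.
by move: pp1; rewrite p1E.
Qed.

(** A difference costs a factor 2 at the archimedean places, of total degree
    [d], and nothing at the others. *)
Lemma liouville (iota : {rmorphism K -> R}) (x y : K) : x != y ->
  1 <= `|iota (x - y)| * 2 ^+ \dim {:K} *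
    (weil_height R x * weil_height R y) ^+ \dim {:K}.
Proof.
move=> xy; set z := x - y; have z0 : z != 0 by rewrite subr_eq0.
set d := \dim {:K}.
have [P [ev [[mP irrP] sP evZ evker evsurj]]] := number_field_presentation K.
have [rep repK] := choice evsurj.
pose N := field_norm P d rep z.
have N0 : N != 0 by exact: (field_norm_neq0 irrP sP evker repK z0).
pose ps := primes (`|numq N| * `|denq N|).
have ps_prime p : p \in ps -> prime p by rewrite mem_primes => /andP[].
have [sa [usa sda hsa iota_sa hNa]] :=
  archimedean_places_above mP irrP sP evZ evker repK iota.
have [sp hsp] : exists sp : nat -> seq ((K -> R) * nat), forall p, prime p ->
  [/\ uniq (unzip1 (sp p)),
      forall v, v \in sp p -> (v.2 <= local_degree v.1)%N /\ place_over p v.1 &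
      padic_abs R p N <= \prod_(v <- sp p) v.1 z ^+ v.2].
  suff /choice[sp h] : forall p, exists s : seq ((K -> R) * nat), prime p ->
    [/\ uniq (unzip1 s),
      forall v, v \in s -> (v.2 <= local_degree v.1)%N /\ place_over p v.1 &
      padic_abs R p N <= \prod_(v <- s) v.1 z ^+ v.2] by exists sp.
  move=> p; have [pp|] := boolP (prime p); last by exists [::].
  have [s [us hs hN]] := padic_places_above R mP irrP sP evZ evker repK pp.
  by exists s => _; split=> [//|v /hs[] //|]; exact: hN.
pose s := sa ++ flatten [seq sp p | p <- ps].
have in_sf (L : seq nat) v : v \in flatten [seq sp p | p <- L] ->
    exists2 p, p \in L & v \in sp p.
  by move/flatten_mapP => [p pL vp]; exists p.
have us : uniq (unzip1 s).
  rewrite /unzip1 map_cat cat_uniq -/(unzip1 sa) usa /=; apply/andP; split.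
    apply/hasPn => _ /mapP[v /in_sf[p pL vp] ->]; apply/negP => /mapP[u us' uv].
    have pp := ps_prime p pL; have [_ hs _] := hsp p pp.
    apply: (archimedean_place_not_over pp (proj2 (hsa u us'))).
    by rewrite -uv; exact: (proj2 (hs v vp)).
  have : uniq ps by exact: primes_uniq.
  elim: (ps) ps_prime => [//|p L IH] hL /= /andP[pL uL].
  have pp : prime p by apply: hL; rewrite mem_head.
  have [up hp _] := hsp p pp.
  rewrite map_cat cat_uniq -/(unzip1 (sp p)) up IH ?andbT //=; last first.
    by move=> r rL; apply: hL; rewrite inE rL orbT.
  apply/hasPn => _ /mapP[v /in_sf[r rL vr] ->]; apply/negP => /mapP[u us' uv].
  have pr : prime r by apply: hL; rewrite inE rL orbT.
  have [_ hr _] := hsp r pr.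
  move: pL; rewrite (place_over_inj pp pr (proj2 (hp u us'))) ?rL //.
  by rewrite -uv; exact: (proj2 (hr v vr)).
have hs v : v \in s -> (v.2 <= local_degree v.1)%N /\ @places R K v.1.
  rewrite mem_cat => /orP[/hsa[? ?]|/in_sf[p pL vp]]; first by split=> //; left.
  have [_ hp _] := hsp p (ps_prime p pL).
  by have [? [? _]] := hp v vp; split=> //; right.
pose M u (v : (K -> R) * nat) := Num.max 1 (v.1 u) ^+ v.2.
have M1 u v : 1 <= M u v by rewrite exprn_ege1 // le_max lexx.
have M0 u v : 0 <= M u v by exact: le_trans (M1 u v).
pose v0 : (K -> R) * nat := ((fun x => `|iota x|), 1%N).
have {}iota_sa : v0 \in sa by exact: iota_sa.
(* At the place given by [iota] one factor [|iota z|] is kept. *)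
have arch : \prod_(v <- sa) v.1 z ^+ v.2 <=
    `|iota z| * 2 ^+ d * (\prod_(v <- sa) M x v * \prod_(v <- sa) M y v).
  have bnd v : v \in sa -> v.1 z ^+ v.2 <= 2 ^+ v.2 * (M x v * M y v).
    move=> /hsa[_ /archimedean_place_ms mv]; rewrite -!exprMn lerXn2r ?nnegrE ?(ms_ge0 mv) //.
      by rewrite mulr_ge0 // mulr_ge0 // (le_trans ler01) // le_max lexx.
    rewrite (le_trans (msB mv _ _)) // mulr_natl mulr2n.
    by rewrite lerD ?le_max1M // mulrC le_max1M.
  rewrite -big_split /= (big_rem _ iota_sa) /= [in leRHS](big_rem _ iota_sa) /=.
  rewrite expr1.
  have sd : d = (1 + \sum_(v <- rem v0 sa) v.2)%N.
    by rewrite /d -sda (big_rem _ iota_sa).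
  rewrite sd exprD expr1 -!mulrA ler_wpM2l //.
  set rs := rem _ sa.
  have rsE : 2 ^+ (\sum_(v <- rs) v.2) = \prod_(v <- rs) 2 ^+ v.2 :> R.
    by rewrite expr_sum.
  apply: (@le_trans _ _ (\prod_(v <- rs) (2 ^+ v.2 * (M x v * M y v)))).
    rewrite [leLHS]big_seq [leRHS]big_seq; apply: ler_prod => v vr.
    have vs := mem_rem vr; rewrite bnd // andbT exprn_ge0 //.
    by have [_ /archimedean_place_ms mv] := hsa v vs; exact: (ms_ge0 mv).
  rewrite big_split /= -rsE.
  set A := \prod_(v <- rs) _; set B := 2 ^+ _.
  have A0 : 0 <= A by apply: prodr_ge0 => v _; exact: mulr_ge0.
  have B0 : 0 <= B by exact: exprn_ge0.
  have C1 := M1 x v0.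
  have D1 := M1 y v0.
  move: (M x _) (M y _) C1 D1 => C D C1 D1.
  have CD : 1 <= C * D by rewrite mulr_ege1.
  have BA : 0 <= B * A by exact: mulr_ge0.
  nra.
have fin : \prod_(p <- ps) padic_abs R p N <=
    \prod_(v <- flatten [seq sp p | p <- ps]) M x v *
    \prod_(v <- flatten [seq sp p | p <- ps]) M y v.
  rewrite -big_split /= big_flatten /= big_map [leLHS]big_seq [leRHS]big_seq.
  apply: ler_prod => p pL; have pp := ps_prime p pL; have [_ hp hN] := hsp p pp.
  rewrite padic_abs_ge0 //= (le_trans hN) // [leLHS]big_seq [leRHS]big_seq.
  apply: ler_prod => v /hp[_ hv]; have mv := place_over_ms hv.
  rewrite exprn_ge0 ?(ms_ge0 mv) //= -exprMn lerXn2r ?nnegrE ?(ms_ge0 mv) //.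
    by rewrite mulr_ge0 // (le_trans ler01) // le_max lexx.
  have := place_over_ultra hv x (- y); rewrite (msN mv) => h.
  by rewrite (le_trans h) // ge_max le_max1M mulrC le_max1M.
have hx := weil_height_ge x us hs; have hy := weil_height_ge y us hs.
rewrite -[leLHS](rat_product_formula R N0) -/ps.
apply: (@le_trans _ _ ((`|iota z| * 2 ^+ d * (\prod_(v <- sa) M x v * \prod_(v <- sa) M y v)) *
  (\prod_(v <- flatten [seq sp p | p <- ps]) M x v *
    \prod_(v <- flatten [seq sp p | p <- ps]) M y v))).
  apply: ler_pM => //; last exact: le_trans (hNa z) arch.
  by apply: prodr_ge0 => p _; exact: padic_abs_ge0.
rewrite -mulrA ler_wpM2l ?mulr_ge0 ?exprn_ge0 // mulrACA -!big_cat exprMn.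
by apply: ler_pM => //; apply: prodr_ge0.
Qed.

End Liouville.

(** The integer parts of the [x / e] are distinct. *)
Lemma separated_points_bound (R : realType) (s : seq R) (c e : R) :
  0 < e -> 0 <= c -> uniq s -> (forall x, x \in s -> 0 <= x <= c) ->
  (forall x y, x \in s -> y \in s -> x != y -> e <= `|x - y|) ->
  (size s)%:R <= c / e + 1.
Proof.
move=> e0 c0 us hs sep; pose t x := Num.truncn (x / e).
have ge0 x : x \in s -> 0 <= x / e.
  by move=> /hs/andP[x0 _]; rewrite divr_ge0 // ltW.
have tinj : {in s &, injective t}.
  move=> x y xs ys txy; apply/eqP/negPn/negP => xy; have := sep x y xs ys xy.
  apply/negP; rewrite -ltNge.
  have /andP[x1 x2] := truncn_itv (ge0 x xs); have /andP[y1 y2] := truncn_itv (ge0 y ys).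
  rewrite -/(t x) -natr1 in x1 x2; rewrite -/(t y) -txy -natr1 in y1 y2.
  have : `|x / e - y / e| < 1 by rewrite ltr_norml; apply/andP; split; lra.
  by rewrite -mulrBl normrM normfV (gtr0_norm e0) ltr_pdivrMr // mul1r.
have ce0 : 0 <= c / e by rewrite divr_ge0 // ltW.
apply: (@le_trans _ _ (Num.truncn (c / e)).+1%:R); last first.
  by rewrite -natr1 lerD2r; have /andP[] := truncn_itv ce0.
rewrite ler_nat -(size_map t) -[leqRHS](size_iota 0).
apply: uniq_leq_size; first by rewrite map_inj_in_uniq.
move=> _ /mapP[x xs ->]; rewrite mem_iota add0n ltnS /=.
rewrite truncn_ge_nat //; have /andP[h _] := truncn_itv (ge0 x xs).
by rewrite (le_trans h) // ler_pM2r ?invr_gt0 //; have /andP[] := hs x xs.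
Qed.

(** * Well-rounded planar lattices *)

Section Lattices.
Variable R : realType.
Implicit Types (L : set 'cV[R]_2) (u w : 'cV[R]_2) (B : 'M[R]_2).

Lemma sum_I2 (V : nmodType) (G : 'I_2 -> V) : \sum_i G i = G 0 + G 1.
Proof.
rewrite !big_ord_recl big_ord0 addr0; congr (_ + G _); exact: val_inj.
Qed.

Lemma forall_I2 (Q : 'I_2 -> Prop) : Q 0 -> Q 1 -> forall i, Q i.
Proof.
move=> Q0 Q1 [[|[|//]] hi].
- by have -> : Ordinal hi = 0 by exact: val_inj.
- by have -> : Ordinal hi = 1 by exact: val_inj.
Qed.

Lemma det_mx2 (A : 'M[R]_2) : \det A = A 0 0 * A 1 1 - A 0 1 * A 1 0.
Proof.
rewrite (expand_det_row _ 0) sum_I2 /cofactor !det_mx11 !mxE /=.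
have -> : lift 0 0 = 1 :> 'I_2 by exact: val_inj.
have -> : lift 1 0 = 0 :> 'I_2 by exact: val_inj.
by rewrite expr0 mul1r expr1 mulN1r mulrN.
Qed.

Lemma similar_trans L1 L2 L3 : Defs.similar L1 L2 -> Defs.similar L2 L3 -> Defs.similar L1 L3.
Proof.
move=> [a [U [a0 oU ->]]] [b [V [b0 oV ->]]].
exists (b * a), (V *m U); split; first exact: mulr_gt0.
  by rewrite trmx_mul mulmxA -(mulmxA _ _ V) oV mulmx1.
rewrite image_comp; congr image; apply/funext => u /=.
by rewrite -scalemxAr scalerA mulmxA.
Qed.

Lemma similar_sym L1 L2 : Defs.similar L1 L2 -> Defs.similar L2 L1.
Proof.
move=> [a [U [a0 oU ->]]]; exists a^-1, U^T; split; first by rewrite invr_gt0.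
  by rewrite trmxK; exact: mulmx1C.
rewrite image_comp (_ : _ \o _ = id) ?image_id //; apply/funext => u /=.
by rewrite -scalemxAr scalerA mulVf ?gt_eqF // scale1r mulmxA oU mul1mx.
Qed.

Lemma similarity_class_eq L1 L2 L : Defs.similar L1 L -> Defs.similar L2 L ->
  similarity_class L1 = similarity_class L2.
Proof.
move=> h1 h2; have h12 := similar_trans h1 (similar_sym h2).
apply/seteqP; split=> L' h; last exact: similar_trans h12 h.
exact: similar_trans (similar_sym h12) h.
Qed.

Definition dot u w : R := u 0 0 * w 0 0 + u 1 0 * w 1 0.
Definition cross u w : R := u 0 0 * w 1 0 - u 1 0 * w 0 0.

Lemma euclidean_normE u : euclidean_norm u = Num.sqrt (dot u u).
Proof. by rewrite /euclidean_norm sum_I2 /dot !expr2. Qed.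

Lemma dot_ge0 u : 0 <= dot u u.
Proof. by rewrite /dot -!expr2 addr_ge0 ?sqr_ge0. Qed.

Lemma dot_eq0 u : dot u u = 0 -> u = 0.
Proof.
rewrite /dot -!expr2 => /eqP; rewrite paddr_eq0 ?sqr_ge0 // !sqrf_eq0.
case/andP=> /eqP u0 /eqP u1; apply/colP; apply: forall_I2; by rewrite mxE.
Qed.

Lemma minimal_vectorsP L u w : minimal_vectors L u -> L w -> w != 0 ->
  dot u u <= dot w w.
Proof.
by case=> _ _ h Lw w0; have := h w Lw w0; rewrite !euclidean_normE ler_sqrt ?dot_ge0.
Qed.

Definition col2 u w : 'M[R]_2 := \matrix_(i, k) (if k == 0 then u i 0 else w i 0).

Lemma mul_col2 u w (z : 'cV[R]_2) : col2 u w *m z = z 0 0 *: u + z 1 0 *: w.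
Proof.
by apply/colP => i; rewrite !mxE sum_I2 !mxE /= mulrC [w i 0 * _]mulrC.
Qed.

Lemma lattice_closed B u w (m n : int) : lattice_of B u -> lattice_of B w ->
  lattice_of B (m%:~R *: u + n%:~R *: w).
Proof.
case=> z _ <- [t _ <-]; exists (m *: z + n *: t) => //.
rewrite !scalemxAr -mulmxDr; congr (B *m _).
by apply/matrixP => i k; rewrite !mxE rmorphD !rmorphM.
Qed.

(** Otherwise the minimal vectors would lie on one line. *)
Lemma independent_minimal_vectors L : spans_plane (minimal_vectors L) ->
  exists u w, [/\ minimal_vectors L u, minimal_vectors L w & cross u w != 0].
Proof.
move=> sp; apply: contrapT => h.
have dep u w : minimal_vectors L u -> minimal_vectors L w -> cross u w = 0.
  by move=> hu hw; apply/eqP/negPn/negP => c; apply: h; exists u, w.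
have cross_lin u (s : seq 'cV[R]_2) w : (forall x, x \in s -> cross u x = 0) ->
    w \in span s -> cross u w = 0.
  move=> hs ws.
  have [k ->] : exists k : 'I_(size s) -> R, w = \sum_i k i *: s`_i.
    exists (fun i => coord (in_tuple s) i w).
    exact: (@coord_span _ _ _ (in_tuple s)).
  rewrite /cross !summxE !mulr_sumr -sumrB big1 // => i _.
  have := hs _ (mem_nth 0 (ltn_ord i)); rewrite /cross !mxE.
  move=> e; have -> : forall (a b c d k : R), a * (k * b) - c * (k * d) = k * (a * b - c * d).
    by move=> *; ring.
  by rewrite e mulr0.
have [u hu] : exists u, minimal_vectors L u.
  apply: contrapT => nu; have [[|x s] hs] := sp (delta_mx 0 0).
    rewrite span_nil memv0 => /eqP/matrixP/(_ 0 0); rewrite !mxE eqxx /=.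
    by move/eqP; rewrite oner_eq0.
  by case: nu; exists x; apply: hs; rewrite mem_head.
have c0 w : cross u w = 0.
  have [s hs ws] := sp w; apply: (cross_lin u s w) => // x xs.
  by apply: dep => //; exact: hs.
case: hu => _ /eqP u0 _; apply: u0; apply: dot_eq0.
have := c0 (\col_i (if i == 0 then - u 1 0 else u 0 0)).
by rewrite /cross !mxE /= mulrN opprK.
Qed.

Lemma lattice_col2 u w : lattice_of (col2 u w) =
  [set v | exists m n : int, v = m%:~R *: u + n%:~R *: w].
Proof.
apply/seteqP; split=> v.
  by case=> z _ <-; exists (z 0 0), (z 1 0); rewrite mul_col2 !mxE.
case=> m [n ->]; exists (\col_i (if i == 0 then m else n)) => //.
by rewrite mul_col2 !mxE.
Qed.

Lemma nearest_int (a : R) : exists m : int, `|a - m%:~R| <= 1 / 2.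
Proof.
exists (Num.floor (a + 1 / 2)); have := floor_itv (a + 1 / 2).
by rewrite intrD => /andP[h1 h2]; rewrite ler_norml; apply/andP; split; lra.
Qed.

(** Two independent minimal vectors with a non-obtuse angle generate the
    lattice: after rounding its coordinates, any vector of the lattice becomes
    shorter than the minimum. *)
Lemma well_rounded_basis L : well_rounded L -> exists u w,
  [/\ L = lattice_of (col2 u w), cross u w != 0, dot u u = dot w w,
      0 <= dot u w & 2 * dot u w <= dot u u].
Proof.
move=> [[B _ LE] /independent_minimal_vectors[u [w' [hu hw' c']]]].
have closed (m n : int) v v' : L v -> L v' -> L (m%:~R *: v + n%:~R *: v').
  by rewrite LE; exact: lattice_closed.
have [w [hw c d0]] : exists w, [/\ minimal_vectors L w, cross u w != 0 & 0 <= dot u w].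
  have [d0|/ltW d0] := leP 0 (dot u w'); first by exists w'.
  have [Lw' w'0 mw'] := hw'.
  exists (- w'); split.
  - split; last 1 first.
    + move=> v Lv v0; rewrite !euclidean_normE /dot !mxE !mulrNN.
      by have := mw' v Lv v0; rewrite !euclidean_normE.
    + by have := closed 0 (- 1) _ _ Lw' Lw'; rewrite scale0r add0r scaleN1r.
    + by rewrite oppr_eq0.
  - by move: c'; rewrite /cross !mxE !mulrN -opprD oppr_eq0.
  - by move: d0; rewrite /dot !mxE !mulrN -opprD oppr_ge0.
have [Lu u0 _] := hu; have [Lw w0 _] := hw.
have duw : dot u u = dot w w.
  by apply/eqP; rewrite eq_le (minimal_vectorsP hu) ?(minimal_vectorsP hw).
have N0 : 0 < dot u u.
  by rewrite lt_def dot_ge0 andbT; apply: contra u0 => /eqP/dot_eq0 ->.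
have d2 : 2 * dot u w <= dot u u.
  have Luw : L (u - w).
    by have := closed 1 (- 1) _ _ Lu Lw; rewrite scale1r scaleN1r.
  have uw0 : u - w != 0.
    rewrite subr_eq0; apply: contra c => /eqP ->.
    by rewrite /cross mulrC subrr.
  have := minimal_vectorsP hu Luw uw0.
  have -> : dot (u - w) (u - w) = dot u u + dot w w - 2 * dot u w.
    by rewrite /dot !mxE; ring.
  by rewrite -duw; lra.
exists u, w; split => //; rewrite lattice_col2; apply/seteqP; split=> v; last first.
  by case=> m [n ->]; exact: closed.
move=> Lv.
pose a := cross v w / cross u w; pose b := cross u v / cross u w.
have vE : v = a *: u + b *: w.
  by apply/colP; apply: forall_I2; rewrite !mxE /a /b; move: c; rewrite /cross => c; field.
have [m hm] := nearest_int a; have [n hn] := nearest_int b.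
exists m, n; apply/eqP; rewrite -subr_eq0; apply/negPn/negP => r0.
set r := v - _ in r0.
have Lr : L r.
  have Lmn := closed m n _ _ Lu Lw.
  by have := closed 1 (- 1) _ _ Lv Lmn; rewrite scale1r scaleN1r.
have := minimal_vectorsP hu Lr r0.
have -> : dot r r = (a - m%:~R) ^+ 2 * dot u u + (b - n%:~R) ^+ 2 * dot w w +
    2 * (a - m%:~R) * (b - n%:~R) * dot u w.
  by rewrite /r vE /dot !mxE; ring.
rewrite -duw; move: hm hn; rewrite !ler_norml.
move: (a - _) (b - _) (dot u u) (dot u w) N0 d0 d2 => {a b vE} a b N d N0 d0 d2.
move=> /andP[a1 a2] /andP[b1 b2].
have aa : a ^+ 2 <= 1 / 4 by nra.
have bb : b ^+ 2 <= 1 / 4 by nra.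
have ab : 2 * a * b <= 1 / 2 by nra.
apply/negP; rewrite -ltNge.
have h1 : 2 * a * b * d <= 1 / 2 * d by rewrite ler_wpM2r.
have h2 : a ^+ 2 * N <= 1 / 4 * N by rewrite ler_wpM2r // ltW.
have h3 : b ^+ 2 * N <= 1 / 4 * N by rewrite ler_wpM2r // ltW.
lra.
Qed.

Lemma mx_of_paramE (x : R) : mx_of_param x =
  col2 (\col_i (if i == 0 then 1 else x)) (\col_i (if i == 0 then x else 1)).
Proof.
apply/matrixP; apply: forall_I2; apply: forall_I2; by rewrite !mxE.
Qed.

(** The parameter is the tangent of half the complement of the angle between
    the two basis vectors; [c] and [s] are the cosine and sine of this angle. *)
Lemma well_rounded_similar L : well_rounded L -> exists x : R,
  0 <= x <= 2 - Num.sqrt 3 /\ Defs.similar L (lattice_of (mx_of_param x)).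
Proof.
case/well_rounded_basis => u [w [-> cr duw d0 d2]].
have u0 : u != 0 by apply: contra cr => /eqP ->; rewrite /cross !mxE !mul0r subrr.
have N0 : 0 < dot u u.
  by rewrite lt_def dot_ge0 andbT; apply: contra u0 => /eqP/dot_eq0 ->.
pose c := dot u w / dot u u; pose s := Num.sqrt (1 - c ^+ 2).
have c0 : 0 <= c by rewrite divr_ge0 // ltW.
have c2 : c <= 1 / 2 by rewrite ler_pdivrMr //; lra.
have s2 : s ^+ 2 = 1 - c ^+ 2 by rewrite sqr_sqrtr //; nra.
have s0 : 0 <= s by exact: sqrtr_ge0.
pose x := c / (1 + s).
have s10 : 1 + s != 0 by rewrite gt_eqF //; lra.
have x1 : 1 + x ^+ 2 = 2 / (1 + s).
  rewrite /x expr_div_n; have -> : c ^+ 2 = 1 - s ^+ 2 by lra.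
  by field.
have t0 : 0 <= Num.sqrt 3 :> R by exact: sqrtr_ge0.
have t2 : Num.sqrt 3 ^+ 2 = 3 :> R by rewrite sqr_sqrtr.
exists x; split.
  apply/andP; split; first by rewrite divr_ge0 //; lra.
  have st : Num.sqrt 3 <= 2 * s.
    rewrite -(@ler_pXn2r _ 2) ?nnegrE ?mulr_ge0 // t2 exprMn s2; nra.
  rewrite ler_pdivrMr; last by lra.
  have t1 : Num.sqrt 3 <= 2 :> R.
    by rewrite -(@ler_pXn2r _ 2) ?nnegrE // t2; lra.
  nra.
pose a := Num.sqrt ((1 + x ^+ 2) / dot u u).
have a2 : a ^+ 2 * dot u u = 1 + x ^+ 2.
  by rewrite sqr_sqrtr ?divfK ?gt_eqF // divr_ge0 ?(ltW N0) // addr_ge0 ?sqr_ge0.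
have a2d : a ^+ 2 * dot u w = 2 * x.
  have -> : dot u w = c * dot u u by rewrite divfK ?gt_eqF.
  by rewrite mulrCA a2 x1 /x; field.
have a0 : 0 < a.
  by rewrite sqrtr_gt0 divr_gt0 // ltr_pwDl ?sqr_ge0.
set M := mx_of_param x; set B := col2 u w.
have gram : M^T *m M = a ^+ 2 *: (B^T *m B).
  have dwu : dot w u = dot u w by rewrite /dot; ring.
  rewrite /M mx_of_paramE; apply/matrixP; apply: forall_I2; apply: forall_I2;
    rewrite !mxE !sum_I2 !mxE /=.
  - by rewrite -[X in a ^+ 2 * X]/(dot u u) a2; ring.
  - by rewrite -[X in a ^+ 2 * X]/(dot u w) a2d; ring.
  - by rewrite -[X in a ^+ 2 * X]/(dot w u) dwu a2d; ring.
  - by rewrite -[X in a ^+ 2 * X]/(dot w w) -duw a2; ring.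
have uB : B \in unitmx.
  by rewrite unitmxE unitfE det_mx2 !mxE /= [w 0 0 * _]mulrC.
exists a, (a^-1 *: (M *m invmx B)); split => //.
- rewrite [(_ *: _)^T]linearZ /= -scalemxAl -scalemxAr scalerA trmx_mul mulmxA -(mulmxA _ M^T).
  rewrite gram -scalemxAr -scalemxAl scalerA -invfM -expr2 mulVf ?expf_neq0 ?gt_eqF //.
  rewrite scale1r mulmxA -trmx_mul mulmxV // trmx1 mul1mx.
  by rewrite mulmxV.
- have key (z : 'cV[R]_2) : a *: (a^-1 *: (M *m invmx B) *m (B *m z)) = M *m z.
    by rewrite -scalemxAl scalerA divff ?gt_eqF // scale1r !mulmxA mulmxKV.
  apply/seteqP; split=> [_ [z _ <-]|_ [_ [z _ <-] <-]].
    by exists (B *m map_mx intr z); [exists z|exact: key].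
  by exists z => //; rewrite key.
Qed.

Lemma orthogonal_dot (U : 'M[R]_2) (a : R) u w : U^T *m U = 1%:M ->
  dot (a *: (U *m u)) (a *: (U *m w)) = a ^+ 2 * dot u w.
Proof.
move=> oU; have dotE v v' : dot v v' = (v^T *m v') 0 0.
  by rewrite mxE sum_I2 !mxE.
rewrite !dotE [(_ *: _)^T]linearZ /= -scalemxAl -scalemxAr scalerA -expr2 mxE; congr (_ * _).
by rewrite trmx_mul mulmxA -(mulmxA _ U^T) oU mulmx1.
Qed.

Lemma orthogonal_cross (U : 'M[R]_2) (a : R) u w :
  cross (a *: (U *m u)) (a *: (U *m w)) = a ^+ 2 * \det U * cross u w.
Proof. by rewrite /cross det_mx2 !mxE !sum_I2; ring. Qed.

Lemma orthogonal_det (U : 'M[R]_2) : U^T *m U = 1%:M -> \det U = 1 \/ \det U = - 1.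
Proof.
move=> /(congr1 determinant); rewrite det_mulmx det_tr det1 -expr2 => /eqP.
by rewrite sqrf_eq1 => /orP[] /eqP; [left|right].
Qed.

(** In a similar lattice, with basis [p], [q], one reads [x] off the similarity
    invariants: [x = p.q / (|p|^2 +- cross p q)]. *)
Lemma param_in_field (K : fieldExtType rat) (iota : {rmorphism K -> R}) (x : R) L :
  Defs.similar (lattice_of (mx_of_param x)) L -> lattice_defined_over iota L ->
  exists k, iota k = x.
Proof.
move=> [a [U [a0 oU ->]]] defK.
pose e1 : 'cV[R]_2 := \col_i (if i == 0 then 1 else x).
pose e2 : 'cV[R]_2 := \col_i (if i == 0 then x else 1).
pose p := a *: (U *m e1); pose q := a *: (U *m e2).
have Le1 : lattice_of (mx_of_param x) e1.
  rewrite mx_of_paramE lattice_col2; exists 1, 0.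
  by rewrite scale1r scale0r addr0.
have Le2 : lattice_of (mx_of_param x) e2.
  rewrite mx_of_paramE lattice_col2; exists 0, 1.
  by rewrite scale1r scale0r add0r.
have /choice[kp hp] : forall i, exists k, p i 0 = iota k by apply: defK; exists e1.
have /choice[kq hq] : forall i, exists k, q i 0 = iota k by apply: defK; exists e2.
have pq : dot p q = a ^+ 2 * (2 * x).
  by rewrite orthogonal_dot // /dot !mxE /=; ring.
have pp : dot p p = a ^+ 2 * (1 + x ^+ 2).
  by rewrite orthogonal_dot // /dot !mxE /=; ring.
have cpq : cross p q = a ^+ 2 * \det U * (1 - x ^+ 2).
  by rewrite orthogonal_cross /cross !mxE /=; ring.
have a20 : a ^+ 2 != 0 by rewrite expf_neq0 ?gt_eqF.
have [e ek eU] : exists2 e : R, (exists k, iota k = e) & e * \det U = 1.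
  have [dU|dU] := orthogonal_det oU; rewrite dU.
    by exists 1; rewrite ?mulr1 //; exists 1; rewrite rmorph1.
  by exists (- 1); rewrite ?mulrNN ?mulr1 //; exists (- 1); rewrite rmorphN1.
have [k kE] := ek.
exists ((kp 0 * kq 0 + kp 1 * kq 1) /
  ((kp 0 * kp 0 + kp 1 * kp 1) + k * (kp 0 * kq 1 - kp 1 * kq 0))).
rewrite fmorph_div !(rmorphD, rmorphN, rmorphM) /= kE -!hp -!hq.
rewrite -/(dot p q) -/(dot p p) -/(cross p q) pq pp cpq.
have -> : a ^+ 2 * (1 + x ^+ 2) + e * (a ^+ 2 * \det U * (1 - x ^+ 2)) =
    a ^+ 2 * (1 + x ^+ 2) + a ^+ 2 * (e * \det U) * (1 - x ^+ 2) by ring.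
by rewrite eU; field; lra.
Qed.

End Lattices.

(** * Counting classes *)

Lemma weil_height_ge0 (R : realType) (K : fieldExtType rat) (x : K) :
  0 <= weil_height R x.
Proof. by apply: prodr_ge0 => v _; exact: powR_ge0. Qed.

Section Counting.
Variables (R : realType) (K : fieldExtType rat) (iota : {rmorphism K -> R}) (T : R).
Implicit Type C : set (set 'cV[R]_2).
Let d := \dim {:K}.
Let S := wr_classes_of_bounded_height iota T.
(** The parameter of a class as the element of [K] whose height is taken. *)
Let kappa C : K := xget 0 [set k | iota k = class_param C].

Lemma class_paramP C : S C ->
  0 <= class_param C <= 2 - Num.sqrt 3 /\ C (lattice_of (mx_of_param (class_param C))).
Proof.
case=> [[L wL ->] _ _]; have [x [hx sx]] := well_rounded_similar wL.
rewrite /class_param; case: xgetP => [y _ //|none].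
by case: (none x).
Qed.

Lemma iota_kappa C : S C -> iota (kappa C) = class_param C.
Proof.
move=> SC; have [_ Cx] := class_paramP SC.
case: SC => [[L _ CE] [L' CL' defK] _].
rewrite /kappa; case: xgetP => [k _ //|none].
suff [k kE] : exists k, iota k = class_param C by case: (none k).
apply: param_in_field defK; move: Cx CL'; set t := class_param C; rewrite CE => h1 h2.
exact: similar_trans (similar_sym h1) h2.
Qed.

Lemma kappa_inj C C' : S C -> S C' -> kappa C = kappa C' -> C = C'.
Proof.
move=> SC SC' kE.
have pE : class_param C = class_param C' by rewrite -!iota_kappa // kE.
have [_ h] := class_paramP SC; have [_ h'] := class_paramP SC'.
rewrite pE in h; set t := class_param C' in h h'.
case: SC SC' => [[L _ CE] _ _] [[L' _ CE'] _ _].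
rewrite CE CE'; rewrite CE in h; rewrite CE' in h'.
exact: similarity_class_eq h h'.
Qed.

Lemma classes_bound (s : seq (set (set 'cV[R]_2))) : 1 <= T -> uniq s ->
  (forall C, C \in s -> S C) ->
  (size s)%:R <= (2 - Num.sqrt 3) * (2 ^+ d * T ^+ (2 * d)) + 1.
Proof.
move=> T1 us hs; have T0 : 0 < T by exact: lt_le_trans T1.
have s3 : Num.sqrt 3 <= 2 :> R.
  by rewrite -(@ler_pXn2r _ 2) ?nnegrE ?sqrtr_ge0 // sqr_sqrtr //; lra.
have D0 : 0 < 2 ^+ d * T ^+ (2 * d) by rewrite mulr_gt0 ?exprn_gt0.
rewrite -[2 ^+ d * _]invrK -(size_map (fun C => iota (kappa C))).
apply: separated_points_bound.
- by rewrite invr_gt0.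
- by rewrite subr_ge0.
- rewrite map_inj_in_uniq // => C C' Cs Cs' /fmorph_inj.
  exact: kappa_inj (hs _ Cs) (hs _ Cs').
- move=> _ /mapP[C Cs ->]; rewrite iota_kappa; last exact: hs.
  by have [] := class_paramP (hs C Cs).
move=> _ _ /mapP[C Cs ->] /mapP[C' Cs' ->] CC'.
have neq : kappa C != kappa C' by apply: contra CC' => /eqP ->.
have := liouville iota neq; rewrite -/d => h.
have hT : (weil_height R (kappa C) * weil_height R (kappa C')) ^+ d <= T ^+ (2 * d).
  have bnd A : S A -> weil_height R (kappa A) <= T by case.
  rewrite exprM lerXn2r ?nnegrE ?mulr_ge0 ?weil_height_ge0 ?exprn_ge0 ?(ltW T0) //.
  by rewrite expr2 ler_pM ?weil_height_ge0 // bnd //; exact: hs.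
rewrite -rmorphB -[leLHS]mul1r ler_pdivrMr // (le_trans h) // mulrA.
by rewrite ler_wpM2l // mulr_ge0 // exprn_ge0.
Qed.

End Counting.

Lemma count_bound_le (R : realType) (d : nat) (T : R) : 1 <= T ->
  (2 - Num.sqrt 3) * (2 ^+ d * T ^+ (2 * d)) + 1 <=
  pi / (2 * Num.sqrt 12) *
      (1 + 4 ^+ (2 * (d + 1)) * (2 + Num.sqrt 3) ^+ d * T ^+ (2 * d)).
Proof.
move=> T1.
have s3 : 1 <= Num.sqrt 3 :> R.
  by rewrite -(@ler_pXn2r _ 2) ?nnegrE ?sqrtr_ge0 // sqr_sqrtr //; lra.
have s0 : 0 < Num.sqrt 12 :> R by rewrite sqrtr_gt0.
have s12 : Num.sqrt 12 <= 4 :> R.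
  by rewrite -(@ler_pXn2r _ 2) ?nnegrE ?sqrtr_ge0 // sqr_sqrtr //; lra.
have X1 : 1 <= T ^+ (2 * d) by exact: exprn_ege1.
have Y1 : 1 <= 2 ^+ d :> R by rewrite exprn_ege1 //; lra.
have Z : 2 ^+ d <= (2 + Num.sqrt 3) ^+ d :> R.
  by rewrite lerXn2r ?nnegrE //; lra.
have W : 16 <= 4 ^+ (2 * (d + 1)) :> R.
  rewrite exprM (_ : 4 ^+ 2 = 16 :> R); last by rewrite expr2; lra.
  by rewrite addn1 exprS ler_peMr // exprn_ege1 //; lra.
have c : 1 / 4 <= pi / (2 * Num.sqrt 12) :> R.
  have := pi_ge2 R; rewrite ler_pdivlMr; [|lra..].
  lra.
set Y := 2 ^+ d * T ^+ (2 * d).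
have Y0 : 1 <= Y by rewrite mulr_ege1.
have B : 16 * Y <= 4 ^+ (2 * (d + 1)) * (2 + Num.sqrt 3) ^+ d * T ^+ (2 * d).
  rewrite -mulrA ler_pM //; first by rewrite (le_trans ler01).
  by rewrite ler_wpM2r // (le_trans ler01).
move: (4 ^+ _ * _ * _) B => V B.
apply: (@le_trans _ _ (1 / 4 * (1 + V))); last by rewrite ler_wpM2r //; lra.
have : (2 - Num.sqrt 3) * Y <= 1 * Y by rewrite ler_wpM2r //; lra.
lra.
Qed.

Theorem theorem1p2 (R : realType) (K : fieldExtType rat)
    (iota : {rmorphism K -> R}) (d : nat) (hd : d = \dim {:K})
    (T : R) (hT : 1 <= T) :
  finite_set (wr_classes_of_bounded_height iota T) /\
  (#|` fset_set (wr_classes_of_bounded_height iota T) |)%:R <=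
    pi / (2 * Num.sqrt 12) *
      (1 + 4 ^+ (2 * (d + 1)) * (2 + Num.sqrt 3) ^+ d * T ^+ (2 * d)) :> R.
Proof.
set S := wr_classes_of_bounded_height iota T.
set bound := _ * (1 + _).
have bnd (s : seq (set (set 'cV[R]_2))) : uniq s -> (forall C, C \in s -> S C) ->
    (size s)%:R <= bound.
  move=> us hs; apply: le_trans (classes_bound hT us hs) _.
  by rewrite -hd; exact: count_bound_le.
have finS : finite_set S.
  apply: contrapT => inf.
  have [B BS cB] := infinite_set_fset (Num.truncn bound).+1 inf.
  have := bnd B (fset_uniq B) (fun C CB => BS C CB).
  apply/negP; rewrite -ltNge (lt_le_trans (truncnS_gt bound)) //.
  by rewrite ler_nat.
split=> //; apply: bnd; first exact: fset_uniq.
by move=> C; rewrite in_fset_set // inE.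
Qed.
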